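(* Let $G$ be any one of the five groups $\mathfrak G,\tilde{\mathfrak G}<\mathrm{Aut}(\mathcal T_2)$, $\Gamma,\overline\Gamma,\overline{\overline\Gamma}<\mathrm{Aut}(\mathcal T_3)$ defined in the context. Let $e=e_1e_2\dots$ be a ray in the corresponding tree, let $P=\mathrm{Stab}_G(e)$, and for $n\in\mathbb N$ let $P_n=\mathrm{Stab}_G(e_1\dots e_n)$. Then $(G,P)$ is a Gelfand pair, and $(G,P_n)$ is a Gelfand pair for every $n\in\mathbb N$.
   Context: For $\Sigma=\{1,\dots,d\}$, $\mathcal T_d=\Sigma^*$ is the rooted tree whose vertices are the finite words over $\Sigma$, the children of $\sigma$ being the words $\sigma s$, $s\in\Sigma$. A ray is an element of $\Sigma^{\mathbb N}$, i.e. an infinite geodesic starting at the root. For $h\in\mathrm{Aut}(\mathcal T_d)$ fixing all words of length $1$, write $\psi(h)=(h_1,\dots,h_d)$ if $h(i\tau)=i\,h_i(\tau)$ for all $i\in\Sigma$, $\tau\in\Sigma^*$. Groups on $\mathcal T_2$: let $a$ be the automorphism exchanging the two branches at the root ($a(1\tau)=2\tau$, $a(2\tau)=1\tau$). Define recursively $b,c,d$ by $\psi(b)=(a,c)$, $\psi(c)=(a,d)$, $\psi(d)=(1,b)$, and $\mathfrak G=\langle a,b,c,d\rangle$. Define recursively $\tilde b,\tilde c,\tilde d$ by $\psi(\tilde b)=(a,\tilde c)$, $\psi(\tilde c)=(1,\tilde d)$, $\psi(\tilde d)=(1,\tilde b)$, and $\tilde{\mathfrak G}=\langle a,\tilde b,\tilde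 c,\tilde d\rangle$. Groups on $\mathcal T_3$: let $a$ be the automorphism cyclically permuting the three branches at the root ($1\tau\mapsto2\tau\mapsto3\tau\mapsto1\tau$). Define recursively $r,s,t$ by $\psi(r)=(a,1,r)$, $\psi(s)=(a,a,s)$, $\psi(t)=(a,a^{-1},t)$, and $\Gamma=\langle a,r\rangle$, $\overline\Gamma=\langle a,s\rangle$, $\overline{\overline\Gamma}=\langle a,t\rangle$. In these formulas $1$ as a component denotes the identity automorphism. For a (discrete) group $G$ and a subgroup $H$, $\rho_{G/H}$ is the unitary representation of $G$ on $\ell^2(G/H)$ (complex coefficients) by left translation, and the Hecke algebra is $\mathcal H(G,H)=\mathrm{End}_G(\ell^2(G/H))$ (bounded $G$-equivariant operators). $(G,H)$ is a Gelfand pair if all irreducible subrepresentations of $\rho_{G/H}$ have multiplicity $1$; equivalently, $\mathcal H(G,H)$ is commutative. *)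

(* Defs.v *)
From HB Require Import structures.
From mathcomp Require Import all_boot all_order perm all_algebra.
From mathcomp Require Import all_classical all_reals all_analysis.
From mathcomp Require Import complex ring lra.

Set Implicit Arguments.
Unset Strict Implicit.
Unset Printing Implicit Defensive.

Import Order.TTheory GRing.Theory Num.Theory.
Import numFieldNormedType.Exports.

Local Open Scope classical_set_scope.
Local Open Scope ring_scope.
Local Open Scope complex_scope.

(** * Generated subgroups and left cosets of a (possibly infinite) group *)

Section Subgroups.
Variable gT : groupType.
Implicit Types (A H : set gT).

Definition generated A : set gT :=
  smallest (fun B : set gT => group_closed [in B]) A.

Lemma generated_closed A : group_closed [in generated A].
Proof.
split=> [|x y]; rewrite !inE; first by move=> B [[+ _] _]; rewrite inE.
move=> xA yA B cB; have := cB; case=> -[_ cM] _; apply/set_mem/cM.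
  by apply/mem_set; exact: xA.
by apply/mem_set; exact: yA.
Qed.

(** The subgroup generated by [A], as a group in its own right. *)
Record gen_group A :=
  GenGroup { gen_val :> gT; _ : [in generated A] gen_val }.

HB.instance Definition _ A := [isSub for @gen_val A].
HB.instance Definition _ A := [Choice of gen_group A by <:].
HB.instance Definition _ A := SubChoice_isSubGroup.Build
  gT _ (gen_group A) (generated_closed A).

Definition left_coset (g : gT) A : set gT := [set (g * x)%g | x in A].

Record coset_space H := CosetSpace {
  coset_set : set gT;
  coset_setP : exists g, coset_set = left_coset g H }.

Lemma coset_space_inj H : injective (@coset_set H).
Proof.
by move=> [x px] [y py] /= xy; subst y; congr CosetSpace; exact: Prop_irrelevance.
Qed.

HB.instance Definition _ H := gen_eqMixin (coset_space H).
HB.instance Definition _ H := gen_choiceMixin (coset_space H).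

Lemma left_cosetM g h A : left_coset g (left_coset h A) = left_coset (g * h)%g A.
Proof.
rewrite /left_coset image_comp; apply: eq_imagel => x _ /=.
by rewrite mulgA.
Qed.

Lemma left_coset1 A : left_coset 1%g A = A.
Proof.
rewrite -[RHS]image_id; apply: eq_imagel => x _; exact: mul1g.
Qed.

Lemma translate_subproof H (g : gT) (x : coset_space H) :
  exists h, left_coset g (coset_set x) = left_coset h H.
Proof. by case: x => /= _ [h ->]; exists (g * h)%g; rewrite left_cosetM. Qed.

Definition translate H (g : gT) (x : coset_space H) : coset_space H :=
  CosetSpace (translate_subproof g x).

Lemma translateK H g : cancel (@translate H g) (@translate H g^-1%g).
Proof.
by move=> x; apply: coset_space_inj; rewrite /= left_cosetM mulVg left_coset1.
Qed.

End Subgroups.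

(** * The Hilbert space l^2(T), with complex coefficients *)

Section L2.
Variables (R : realType) (T : choiceType).
Implicit Types (f g : T -> R[i]^o).

Definition normc2 (z : R[i]) : R := complex.Re z ^+ 2 + complex.Im z ^+ 2.

Definition sqsum f : \bar R := (\esum_(x in [set: T]) (normc2 (f x))%:E)%E.

Definition square_summable : pred (T -> R[i]^o) := [pred f | sqsum f < +oo]%E.

Lemma normc2_ge0 z : 0 <= normc2 z.
Proof. by rewrite addr_ge0 ?sqr_ge0. Qed.

Lemma normc2M z w : normc2 (z * w) = normc2 z * normc2 w.
Proof.
by case: z w => [a b] [c d]; rewrite /normc2 /=; ring.
Qed.

Lemma sqsum_ge0 f : (0 <= sqsum f)%E.
Proof. by apply: esum_ge0 => x _; rewrite lee_fin normc2_ge0. Qed.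

Lemma sqsumZ (c : R[i]) f : sqsum (c *: f) = ((normc2 c)%:E * sqsum f)%E.
Proof.
rewrite /sqsum /esum -ereal_supZl ?normc2_ge0 //; last first.
  by apply/set0P; exists 0%E, set0; [exact: fsets_set0 | rewrite fsbig_set0].
congr (ereal_sup _); rewrite image_comp; apply: eq_imagel => A [fA _] /=.
rewrite ge0_mule_fsumr //; last by move=> x; rewrite lee_fin normc2_ge0.
by apply: eq_fsbigr => x _; rewrite -EFinM -normc2M.
Qed.

(** |z + w|^2 <= (1 + s)|z|^2 + (1 + 1/s)|w|^2 gives both closure under sums
    and, optimising over [s], the triangle inequality. *)
Lemma sqsumD (s : R) f g : 0 < s ->
  (sqsum (f + g)%R <= (1 + s)%:E * sqsum f + (1 + s^-1)%:E * sqsum g)%E.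
Proof.
move=> s0.
have s1 : 0 <= 1 + s by rewrite addr_ge0 // ltW.
have s2 : 0 <= 1 + s^-1 by rewrite addr_ge0 // invr_ge0 ltW.
have n2 r : 0 <= r -> normc2 (Num.sqrt r)%:C = r.
  by move=> r0; rewrite /normc2 /= expr0n addr0 sqr_sqrtr.
rewrite -{1}(n2 _ s1) -{1}(n2 _ s2) -!sqsumZ /sqsum -esumD; last 2 first.
- by move=> x _; rewrite lee_fin normc2_ge0.
- by move=> x _; rewrite lee_fin normc2_ge0.
apply: le_esum => x _; rewrite -EFinD lee_fin.
rewrite [normc2 (((_ *: f) : T -> R[i]^o) x)]normc2M.
rewrite [normc2 (((_ *: g) : T -> R[i]^o) x)]normc2M !n2 //.
have -> : (f + g) x = f x + g x by [].
case: (f x) (g x) => [a b] [c e]; rewrite /normc2 /=.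
rewrite -subr_ge0; set D := (X in 0 <= X).
have -> : D = s^-1 * ((s * a - c) ^+ 2 + (s * b - e) ^+ 2).
  by rewrite /D; field; rewrite gt_eqF.
by rewrite mulr_ge0 ?invr_ge0 ?(ltW s0) // addr_ge0 ?sqr_ge0.
Qed.

Lemma square_summable_closed : submod_closed square_summable.
Proof.
have S0 : sqsum (0 : T -> R[i]^o) = 0%E.
  by apply: esum1 => x _; rewrite /normc2 /= expr0n addr0.
split=> [|c f g]; rewrite !inE /=; first by rewrite S0 ltry.
move=> fS gS; apply: le_lt_trans (sqsumD (c *: f) g ltr01) _.
have fin h : (sqsum h < +oo)%E -> sqsum h \is a fin_num.
  by move=> ?; rewrite ge0_fin_numE ?sqsum_ge0.
by rewrite sqsumZ ltey_eq fin_numD !fin_numM ?fin.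
Qed.

Record l2 := L2 { l2_val :> T -> R[i]^o; _ : square_summable l2_val }.

HB.instance Definition _ := [isSub for l2_val].
HB.instance Definition _ := [Choice of l2 by <:].
HB.instance Definition _ := GRing.SubChoice_isSubLmodule.Build
  R[i] (T -> R[i]^o) square_summable l2 square_summable_closed.

Definition l2_norm (f : l2) : R[i] := (Num.sqrt (fine (sqsum f)))%:C.

Lemma sqsum_fin (f : l2) : sqsum f \is a fin_num.
Proof. by rewrite ge0_fin_numE ?sqsum_ge0 //; exact: (valP f). Qed.

Lemma l2_normZ (c : R[i]) (f : l2) : l2_norm (c *: f) = `|c| * l2_norm f.
Proof.
rewrite /l2_norm [l2_val _]/= sqsumZ fineM ?sqsum_fin //=.
by rewrite sqrtrM ?normc2_ge0 // normc_def rmorphM.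
Qed.

Lemma l2_norm_eq0 (f : l2) : l2_norm f = 0 -> f = 0.
Proof.
move=> [/eqP]; rewrite sqrtr_eq0 => f0; apply/val_inj/funext => x /=.
have fx : ((normc2 (f x))%:E <= sqsum f)%E.
  by apply: esum_ge; exists [set x] => //; rewrite fsbig_set1.
have : normc2 (f x) <= 0.
  by rewrite -lee_fin (le_trans fx) // -(fineK (sqsum_fin f)) lee_fin.
rewrite /normc2; case: (f x) => [a b] /= ab0.
have /eqP : a ^+ 2 + b ^+ 2 = 0.
  by apply/eqP; rewrite eq_le ab0 addr_ge0 ?sqr_ge0.
rewrite paddr_eq0 ?sqr_ge0 // !sqrf_eq0 => /andP[/eqP -> /eqP ->].
by [].
Qed.

Lemma l2_normD (f g : l2) : l2_norm (f + g) <= l2_norm f + l2_norm g.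
Proof.
rewrite /l2_norm -rmorphD lecR [l2_val _]/=.
set a := Num.sqrt (fine (sqsum f)); set b := Num.sqrt (fine (sqsum g)).
have fin_ge0 (h : l2) : 0 <= fine (sqsum h) by rewrite fine_ge0 ?sqsum_ge0.
have a2 : fine (sqsum f) = a ^+ 2 by rewrite sqr_sqrtr.
have b2 : fine (sqsum g) = b ^+ 2 by rewrite sqr_sqrtr.
have a0 : 0 <= a by rewrite sqrtr_ge0.
have b0 : 0 <= b by rewrite sqrtr_ge0.
have key s : 0 < s ->
    fine (sqsum (f + g)) <= (1 + s) * a ^+ 2 + (1 + s^-1) * b ^+ 2.
  move=> s0; rewrite -a2 -b2 -lee_fin EFinD !EFinM.
  by rewrite !fineK ?sqsum_fin // ?[(_ + _)%R]/= ?sqsumD //; exact: (sqsum_fin (f + g)).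
case: (eqVneq a 0) => [a_0|a_n0].
  have f0 : f = 0 by apply: l2_norm_eq0; rewrite /l2_norm -/a a_0.
  by rewrite f0 [val _]/= add0r a_0 add0r.
case: (eqVneq b 0) => [b_0|b_n0].
  have g0 : g = 0 by apply: l2_norm_eq0; rewrite /l2_norm -/b b_0.
  by rewrite g0 [val _]/= addr0 b_0 addr0.
have ap : 0 < a by rewrite lt_neqAle eq_sym a_n0.
have bp : 0 < b by rewrite lt_neqAle eq_sym b_n0.
rewrite -(ger0_norm (addr_ge0 a0 b0)) -sqrtr_sqr ler_wsqrtr //.
apply: le_trans (key (b / a) (divr_gt0 bp ap)) _.
suff -> : (1 + b / a) * a ^+ 2 + (1 + (b / a)^-1) * b ^+ 2 = (a + b) ^+ 2 by [].
by field; rewrite a_n0 b_n0.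
Qed.

HB.instance Definition _ :=
  Lmodule_isNormed.Build R[i] l2 l2_normD l2_normZ l2_norm_eq0.

End L2.

(** * Gelfand pairs *)

Section Gelfand.
Variables (R : realType) (gT : groupType) (H : set gT).

Local Notation X := (coset_space H).
Local Notation L2X := (l2 R X).

Lemma sqsum_translate (g : gT) (f : X -> R[i]^o) :
  sqsum (f \o @translate gT H g) = sqsum f.
Proof.
symmetry; apply: (reindex_esum setT setT (@translate gT H g)).
split; first by [].
  by move=> x y _ _; exact: (can_inj (@translateK gT H g)).
move=> x _; exists (translate g^-1%g x) => //=.
by rewrite -{1}(invgK g) translateK.
Qed.

Lemma quasi_regular_subproof (g : gT) (f : L2X) :
  square_summable ((f \o @translate gT H g^-1%g) : X -> R[i]^o).
Proof. by rewrite /square_summable /= sqsum_translate; exact: (valP f). Qed.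

(** The quasi-regular representation: (rho(g) f)(x) = f(g^-1 x). *)
Definition quasi_regular (g : gT) (f : L2X) : L2X :=
  L2 (quasi_regular_subproof g f).

Definition subrep (V : set L2X) : Prop :=
  [/\ V 0,
      forall (c : R[i]) f g, V f -> V g -> V (c *: f + g),
      closed V
    & forall g f, V f -> V (quasi_regular g f)].

Definition irreducible_subrep (V : set L2X) : Prop :=
  [/\ subrep V, V <> [set 0]
    & forall W, subrep W -> W `<=` V -> W = [set 0] \/ W = V].

(** Bounded intertwining operators V -> l^2(G/H); only the values of [T] on
    [V] are relevant. *)
Definition intertwiner (V : set L2X) (T : L2X -> L2X) : Prop :=
  [/\ forall (c : R[i]) f g, V f -> V g -> T (c *: f + g) = c *: T f + T g,
      exists M : R[i], forall f, V f -> `|T f| <= M * `|f|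
    & forall g f, V f -> T (quasi_regular g f) = quasi_regular g (T f)].

(** dim Hom_G(V, l^2(G/H)) = 1. *)
Definition multiplicity_one (V : set L2X) : Prop :=
  exists T0, [/\ intertwiner V T0,
      exists2 f, V f & T0 f <> 0
    & forall T, intertwiner V T ->
        exists c : R[i], forall f, V f -> T f = c *: T0 f].

Definition multiplicity_free : Prop :=
  forall V, irreducible_subrep V -> multiplicity_one V.

Definition hecke_algebra : set {linear L2X -> L2X} :=
  [set T | (exists M : R[i], forall f, `|T f| <= M * `|f|) /\
           forall g f, T (quasi_regular g f) = quasi_regular g (T f)].

Definition hecke_commutative : Prop :=
  forall S T, hecke_algebra S -> hecke_algebra T -> S \o T = T \o S.

(** Multiplicity-freeness and commutativity of the Hecke algebra are the two
    customary definitions; as they need not agree when l^2(G/H) has too few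
    irreducible subrepresentations, both are required. *)
Definition gelfand_pair : Prop := multiplicity_free /\ hecke_commutative.

End Gelfand.

Arguments gelfand_pair R {gT} H.

(** * Automorphisms of the rooted regular tree *)

Section Tree.
Variable d : nat.

Definition word := seq 'I_d.

Definition child (u v : word) : bool := [exists x, v == rcons u x].

Definition is_tree_aut (g : word -> word) : Prop :=
  [/\ bijective g, g [::] = [::] & forall u v, child (g u) (g v) = child u v].

Record tree_aut := TreeAut { aut_fun :> word -> word; autP : is_tree_aut aut_fun }.

Lemma aut_inj : injective aut_fun.
Proof.
by move=> [f pf] [g pg] /= fg; subst g; congr TreeAut; exact: Prop_irrelevance.
Qed.

HB.instance Definition _ := gen_eqMixin tree_aut.
HB.instance Definition _ := gen_choiceMixin tree_aut.

Lemma aut_one_subproof : is_tree_aut id.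
Proof. by split=> //; exists id. Qed.

Lemma aut_mul_subproof (g h : tree_aut) : is_tree_aut (g \o h).
Proof.
case: g h => [g [bg g0 gc]] [h [bh h0 hc]]; split=> /=; first exact: bij_comp.
  by rewrite h0.
by move=> u v; rewrite gc hc.
Qed.

Lemma aut_inv_ex (g : tree_aut) : exists h, cancel g h /\ cancel h g.
Proof. by have [[h gK hK] _ _] := autP g; exists h. Qed.

Definition aut_inv_fun (g : tree_aut) : word -> word := projT1 (cid (aut_inv_ex g)).

Lemma aut_funK g : cancel (aut_fun g) (aut_inv_fun g).
Proof. by rewrite /aut_inv_fun; case: cid => h []. Qed.

Lemma aut_inv_funK g : cancel (aut_inv_fun g) (aut_fun g).
Proof. by rewrite /aut_inv_fun; case: cid => h []. Qed.

Lemma aut_inv_subproof (g : tree_aut) : is_tree_aut (aut_inv_fun g).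
Proof.
have [_ g0 gc] := autP g; split.
- by exists g; [exact: aut_inv_funK | exact: aut_funK].
- by rewrite -{1}g0 aut_funK.
- by move=> u v; rewrite -gc !aut_inv_funK.
Qed.

Definition aut_one := TreeAut aut_one_subproof.
Definition aut_mul g h := TreeAut (aut_mul_subproof g h).
Definition aut_inv g := TreeAut (aut_inv_subproof g).

Lemma aut_mulA : associative aut_mul.
Proof. by move=> f g h; exact: aut_inj. Qed.
Lemma aut_mul1g : left_id aut_one aut_mul.
Proof. by move=> f; exact: aut_inj. Qed.
Lemma aut_mulg1 : right_id aut_one aut_mul.
Proof. by move=> f; exact: aut_inj. Qed.
Lemma aut_mulVg : left_inverse aut_one aut_inv aut_mul.
Proof. by move=> f; apply: aut_inj; apply/funext => w; exact: aut_funK. Qed.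
Lemma aut_mulgV : right_inverse aut_one aut_inv aut_mul.
Proof. by move=> f; apply: aut_inj; apply/funext => w; exact: aut_inv_funK. Qed.

(** The product is composition: (g * h)(w) = g(h(w)). *)
HB.instance Definition _ := isGroup.Build tree_aut
  aut_mulA aut_mul1g aut_mulg1 aut_mulVg aut_mulgV.

(** Automorphisms defined by simultaneous recursion, one for each q : Q, by
    q(i tau) = out q(i) (step q i)(tau). *)
Section Automaton.
Variables (Q : Type) (out : Q -> {perm 'I_d}) (step : Q -> 'I_d -> Q).

Fixpoint run (q : Q) (w : word) : word :=
  if w is i :: w' then out q i :: run (step q i) w' else [::].

Fixpoint run_inv (q : Q) (w : word) : word :=
  if w is j :: w' then
    let i := ((out q)^-1)%g j in i :: run_inv (step q i) w'
  else [::].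

Lemma runK q : cancel (run q) (run_inv q).
Proof. by move=> w; elim: w q => //= i w IH q; rewrite permK IH. Qed.

Lemma run_invK q : cancel (run_inv q) (run q).
Proof. by move=> w; elim: w q => //= i w IH q; rewrite permKV IH. Qed.

Lemma child_run q u v : child (run q u) (run q v) = child u v.
Proof.
have child0 (w : word) : child w [::] = false.
  by apply/existsP => -[x]; case: w.
have child0l (x : 'I_d) w : child [::] (x :: w) = (w == [::]).
  apply/existsP/eqP => [[y /eqP []]//|->]; by exists x.
have childC x y (u' v' : word) : child (x :: u') (y :: v') = (x == y) && child u' v'.
  apply/existsP/andP => [[z /eqP [-> ->]]|[/eqP -> /existsP [z /eqP ->]]].
    by split=> //; apply/existsP; exists z.
  by exists z.
elim: u q v => [|i u IH] q [|j v] /=; rewrite ?child0 ?child0l ?childC //.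
  by case: v.
by rewrite (inj_eq perm_inj); case: eqP => [->|//]; rewrite IH.
Qed.

Lemma run_subproof q : is_tree_aut (run q).
Proof.
split=> //; last exact: child_run.
by exists (run_inv q); [exact: runK | exact: run_invK].
Qed.

Definition automaton_aut (q : Q) : tree_aut := TreeAut (run_subproof q).

End Automaton.

(** [psi h hs] states that h fixes the first level and psi(h) = hs. *)
Definition psi (h : tree_aut) (hs : seq tree_aut) : Prop :=
  forall (i : 'I_d) (tau : word), h (i :: tau) = i :: nth 1%g hs i tau.

Definition ray := nat -> 'I_d.

(** The vertex e_1 ... e_n at level n of the ray e. *)
Definition ray_prefix (e : ray) (n : nat) : word := mkseq e n.

Variable S : set tree_aut.

Definition stab_ray (e : ray) : set (gen_group S) :=
  [set g | aut_fun (val g) \o ray_prefix e = ray_prefix e].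

Definition stab_vertex (w : word) : set (gen_group S) :=
  [set g | aut_fun (val g) w = w].

End Tree.

Arguments stab_ray {d} S e.
Arguments stab_vertex {d} S w.

(** The letters 1, ..., d are the ordinals 0, ..., d - 1; [rot] sends each
    letter to the next one, cyclically. *)
Definition rot d : {perm 'I_d.+2} := perm (@addIr 'I_d.+2 1).

(** ** The groups on the binary tree *)

Variant state2 := One2 | A2 | B2 | C2 | D2 | Bt2 | Ct2 | Dt2.

Definition out2 (q : state2) : {perm 'I_2} := if q is A2 then rot 0 else 1%g.

Definition step2 (q : state2) (i : 'I_2) : state2 :=
  match q with
  | One2 | A2 => One2
  | B2  => nth One2 [:: A2; C2] i
  | C2  => nth One2 [:: A2; D2] i
  | D2  => nth One2 [:: One2; B2] i
  | Bt2 => nth One2 [:: A2; Ct2] i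
  | Ct2 => nth One2 [:: One2; Dt2] i
  | Dt2 => nth One2 [:: One2; Bt2] i
  end.

Definition aut2 : state2 -> tree_aut 2 := automaton_aut out2 step2.

Definition grigorchuk_gens : set (tree_aut 2) :=
  [set g | g \in [:: aut2 A2; aut2 B2; aut2 C2; aut2 D2]].

Definition grigorchuk_tilde_gens : set (tree_aut 2) :=
  [set g | g \in [:: aut2 A2; aut2 Bt2; aut2 Ct2; aut2 Dt2]].

(** ** The groups on the ternary tree *)

Variant state3 := One3 | A3 | A3inv | R3 | S3 | T3.

Definition out3 (q : state3) : {perm 'I_3} :=
  match q with A3 => rot 1 | A3inv => (rot 1)^-1%g | _ => 1%g end.

Definition step3 (q : state3) (i : 'I_3) : state3 :=
  match q with
  | One3 | A3 | A3inv => One3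
  | R3 => nth One3 [:: A3; One3; R3] i
  | S3 => nth One3 [:: A3; A3; S3] i
  | T3 => nth One3 [:: A3; A3inv; T3] i
  end.

Definition aut3 : state3 -> tree_aut 3 := automaton_aut out3 step3.

Definition Gamma_gens : set (tree_aut 3) :=
  [set g | g \in [:: aut3 A3; aut3 R3]].

Definition Gamma_bar_gens : set (tree_aut 3) :=
  [set g | g \in [:: aut3 A3; aut3 S3]].

Definition Gamma_bar_bar_gens : set (tree_aut 3) :=
  [set g | g \in [:: aut3 A3; aut3 T3]].

(** ** The defining recursions *)

Lemma aut2_One : aut2 One2 = 1%g.
Proof.
apply: aut_inj; apply/funext => w /=; elim: w => //= i w ->.
by rewrite perm1.
Qed.

Lemma aut2_A (tau : word 2) :
  aut2 A2 (ord0 :: tau) = ord_max :: tau /\ aut2 A2 (ord_max :: tau) = ord0 :: tau.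
Proof.
have E : run out2 step2 One2 tau = tau by have /(congr1 (@aut_fun 2)) /= -> := aut2_One.
by rewrite /= !E !permE; split; congr (_ :: _); exact: val_inj.
Qed.

Lemma psi_aut2 :
  [/\ psi (aut2 B2) [:: aut2 A2; aut2 C2], psi (aut2 C2) [:: aut2 A2; aut2 D2]
    & psi (aut2 D2) [:: 1%g; aut2 B2]] /\
  [/\ psi (aut2 Bt2) [:: aut2 A2; aut2 Ct2], psi (aut2 Ct2) [:: 1%g; aut2 Dt2]
    & psi (aut2 Dt2) [:: 1%g; aut2 Bt2]].
Proof.
by rewrite -aut2_One; split; split=> -[[|[|//]] ?] tau; rewrite /= perm1.
Qed.

Lemma aut3_One : aut3 One3 = 1%g.
Proof.
apply: aut_inj; apply/funext => w /=; elim: w => //= i w ->.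
by rewrite perm1.
Qed.

Lemma aut3_A (i : 'I_3) (tau : word 3) : aut3 A3 (i :: tau) = (i + 1) :: tau.
Proof.
have E : run out3 step3 One3 tau = tau by have /(congr1 (@aut_fun 3)) /= -> := aut3_One.
by rewrite /= E permE.
Qed.

Lemma aut3_Ainv : aut3 A3inv = (aut3 A3)^-1%g.
Proof.
apply: (mulgI (aut3 A3)); rewrite mulgV; apply: aut_inj; apply/funext => -[//|i w].
have E : run out3 step3 One3 w = w by have /(congr1 (@aut_fun 3)) /= -> := aut3_One.
by rewrite /= !E permKV.
Qed.

Lemma psi_aut3 :
  [/\ psi (aut3 R3) [:: aut3 A3; 1%g; aut3 R3],
      psi (aut3 S3) [:: aut3 A3; aut3 A3; aut3 S3]
    & psi (aut3 T3) [:: aut3 A3; (aut3 A3)^-1%g; aut3 T3]].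
Proof.
rewrite -aut3_One -aut3_Ainv; split=> -[[|[|[|//]]] ?] tau; by rewrite /= perm1.
Qed.

(** ** The five groups *)

Variant five_groups := Grigorchuk | GrigorchukTilde | Gamma | GammaBar | GammaBarBar.

Definition arity (k : five_groups) : nat :=
  match k with Grigorchuk | GrigorchukTilde => 2 | _ => 3 end.

Definition gens (k : five_groups) : set (tree_aut (arity k)) :=
  match k with
  | Grigorchuk => grigorchuk_gens
  | GrigorchukTilde => grigorchuk_tilde_gens
  | Gamma => Gamma_gens
  | GammaBar => Gamma_bar_gens
  | GammaBarBar => Gamma_bar_bar_gens
  end.

Arguments gens k _ : clear implicits.

(* Main.v *)
Require Import Defs.
From HB Require Import structures.
From mathcomp Require Import all_boot all_order perm all_algebra.
From mathcomp Require Import all_classical all_reals all_analysis.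
From mathcomp Require Import complex ring lra zify.

Set Implicit Arguments.
Unset Strict Implicit.
Unset Printing Implicit Defensive.

Import Order.TTheory GRing.Theory Num.Theory.
Import numFieldNormedType.Exports.

Local Open Scope classical_set_scope.
Local Open Scope ring_scope.
Local Open Scope complex_scope.

(** An irreducible closed subspace V of l^2(G/H) is the range of an orthogonal
    projection P in the Hecke algebra, and an intertwiner T on V extends to the
    Hecke operator TP. If the Hecke algebra is commutative, T maps V to itself;
    if moreover TP is annihilated by a split polynomial, T has an eigenvector in
    V, and the eigenspace is all of V by irreducibility.

    For H = P_n, the orbits of G on pairs of vertices of level n are described by
    the length of the common prefix and the difference of the first distinct
    letters. Negating all letters of both words and exchanging the words
    preserves this type, so transposition of kernels, an anti-automorphism of the
    Hecke algebra, is induced by a permutation of G/H; hence commutativity. Every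
    operator is annihilated by its characteristic polynomial.

    For H = P, all P-orbits on G/P outside the base point are infinite, so the
    P-fixed vectors are the multiples of one delta function and every Hecke
    operator is a scalar.

    Both descriptions of orbits rest on the following property: for letters
    i <> j and any x there are elements of G that act trivially below j and as any
    prescribed element of a level-transitive group M below ix. It suffices to
    exhibit such elements for generators of M, which are given as explicit words
    whose sections are computed. *)

(** * Groups acting on rooted trees *)

Section SubgroupPredicates.
Variable gT : groupType.
Implicit Types (A B : set gT).

Definition is_subgroup B : Prop :=
  [/\ B 1%g, forall x y, B x -> B y -> B (x * y)%g
    & forall x, B x -> B x^-1%g].

Lemma is_subgroupP B : group_closed [in B] <-> is_subgroup B.
Proof.
split=> [cB|[B1 BM BV]].
  have [B1 _] := cB; split; first by move: B1; rewrite !inE.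
    move=> x y Bx By; have := group_closedM cB (x := x) (y := y).
    by rewrite !inE; apply.
  by move=> x Bx; have := group_closedV cB (x := x); rewrite !inE; apply.
split=> [|x y]; rewrite !inE // => Bx By.
by apply: BM => //; apply: BV.
Qed.

Lemma generated_subgroup A : is_subgroup (generated A).
Proof. exact/is_subgroupP/generated_closed. Qed.

Lemma sub_generated A : A `<=` generated A.
Proof. by move=> x Ax B [_]; apply. Qed.

Lemma generated_sub A B : is_subgroup B -> A `<=` B -> generated A `<=` B.
Proof. by move=> /is_subgroupP cB AB x; apply; split. Qed.

End SubgroupPredicates.

Section TreeAutomorphisms.
Variable d : nat.
Implicit Types (g h : tree_aut d) (u v : word d).

Lemma autM g h u : (g * h)%g u = g (h u).
Proof. by []. Qed.

Lemma autK g : cancel g g^-1%g.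
Proof. exact: aut_funK. Qed.

Lemma autVK g : cancel g^-1%g g.
Proof. exact: aut_inv_funK. Qed.

Lemma aut_rcons g u x : exists y, g (rcons u x) = rcons (g u) y.
Proof.
have [_ _ gc] := autP g.
have : child u (rcons u x) by apply/existsP; exists x.
by rewrite -gc => /existsP [y /eqP]; exists y.
Qed.

Lemma aut_cat g u v : exists2 w, g (u ++ v) = g u ++ w & size w = size v.
Proof.
elim/last_ind: v => [|v x [w gw sw]]; first by exists [::]; rewrite ?cats0.
have [y gy] := aut_rcons g (u ++ v) x.
exists (rcons w y); last by rewrite !size_rcons sw.
by rewrite -rcons_cat gy gw rcons_cat.
Qed.

Lemma aut_nil g : g [::] = [::].
Proof. by have [] := autP g. Qed.

Lemma size_aut g u : size (g u) = size u.
Proof. by have [w /= -> <-] := aut_cat g [::] u; rewrite aut_nil. Qed.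

Lemma aut_cons g i j u : g [:: i] = [:: j] ->
  exists2 w, g (i :: u) = j :: w & size w = size u.
Proof. by move=> gi; have [w] := aut_cat g [:: i] u; rewrite gi; exists w. Qed.

End TreeAutomorphisms.

(** * Orbits on pairs of vertices of one level *)

Section SelfReplicating.
Variable d : nat.
Implicit Types (g h k : tree_aut d.+2) (u v w : word d.+2) (i j x y : 'I_d.+2).

(** Induction on the length: both first letters are moved to 0, an element matching the two tails is
    lifted below 0, and the result is moved back. *)
Lemma level_transitive (M : set (tree_aut d.+2)) : is_subgroup M ->
    (forall i j, exists2 g, M g & g [:: i] = [:: j]) ->
    (forall g, M g -> exists2 k, M k & forall u, k (0 :: u) = 0 :: g u) ->
  forall u v, size u = size v -> exists2 g, M g & g u = v.
Proof.
move=> [M1 MM MV] Mt Mf u; have [n] := ubnP (size u).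
elim: n u => // n IH [|i u] un [|j v] //= => [_|[suv]].
  by exists 1%g; rewrite ?aut_nil.
have [g Mg gi] := Mt i 0; have [h Mh hj] := Mt j 0.
have [u' gu su] := aut_cons u gi; have [v' hv sv] := aut_cons v hj.
have [||k Mk kuv] := IH u' _ v'; [by rewrite su | by rewrite su sv|].
have [k' Mk' kE] := Mf k Mk.
exists (h^-1 * (k' * g))%g; first by apply: (MM _ _ (MV _ Mh)); apply: MM.
by rewrite !autM gu kE kuv -hv autK.
Qed.

(** Each common letter contributes a 0, and the nonzero difference of the first distinct letters
    closes the code; so the code records both where the words separate and how. *)
Fixpoint pair_type u v : word d.+2 :=
  match u, v with
  | i :: u', j :: v' => if i == j then 0 :: pair_type u' v' else [:: j - i]
  | _, _ => [::]
  end.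

Definition opp_word u : word d.+2 := map -%R u.

Lemma opp_wordK : involutive opp_word.
Proof. by move=> u; rewrite /opp_word -map_comp map_id_in // => x _ /=; rewrite opprK. Qed.

(** Negation and exchange each change the sign of the difference of letters, so together they
    preserve it. *)
Lemma pair_type_opp u v : pair_type (opp_word u) (opp_word v) = pair_type v u.
Proof.
elim: u v => [|i u IH] [|j v] //=; rewrite eqr_opp [j == i]eq_sym IH.
by case: eqP => // _; rewrite opprK addrC.
Qed.

Variables G M : set (tree_aut d.+2).
Hypothesis (sG : is_subgroup G).
Hypothesis G_shift : forall m, exists2 g, G g & forall i u, g (i :: u) = (i + m) :: u.
Hypothesis G_lift : forall i g, G g ->
  exists2 k, G k & forall u, k (i :: u) = i :: g u.
Hypothesis G_pair : forall i j x y x' y', i != j -> exists k,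
  [/\ G k, k [:: i; x] = [:: i; x'] & k [:: j; y] = [:: j; y']].
Hypothesis G_branch : forall i j x g, i != j -> M g -> exists k,
  [/\ G k, forall u, k (j :: u) = j :: u
    & forall u, k (i :: x :: u) = i :: x :: g u].
Hypothesis M_trans : forall u v, size u = size v -> exists2 g, M g & g u = v.

(** Induction on the length. A shift by $i'-i$ aligns the first letters of both words, since equal
    types give $j-i=j'-i'$. If $i=j$, the tails are treated by induction and lifting. *)
Lemma pair_transitive u v u' v' :
  size u = size v -> size u' = size u -> size v' = size u ->
  pair_type u v = pair_type u' v' ->
  exists g, [/\ G g, g u = u' & g v = v'].
Proof.
have [G1 GM GV] := sG.
elim: u v u' v' => [|i u IH] [|j v] [|i' u'] [|j' v'] //=.
  by move=> *; exists 1%g.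
move=> [suv] [su] [sv] T.
have [s Gs sE] := G_shift (i' - i).
have si : s [:: i] = [:: i'] by rewrite sE addrC subrK.
have [eij|nij] := eqVneq i j.
  move: T; rewrite eij eqxx; case: eqVneq => [eij'|]; last first.
    move=> nij' E; have /esym/eqP : 0 = j' - i' by have := congr1 (head 0) E.
    by rewrite subr_eq0 eq_sym (negPf nij').
  move=> [T]; have [g [Gg gu gv]] := IH v u' v' suv su sv T.
  have [k Gk kE] := G_lift i' Gg.
  exists (k * s)%g; split; first exact: GM.
    by rewrite -eij autM sE addrC subrK kE gu.
  by rewrite -eij autM sE addrC subrK kE gv eij'.
move: T; rewrite (negPf nij).
case: eqVneq => [_ E|nij' E].
  have /eqP : j - i = 0 by have := congr1 (head 0) E.
  by rewrite subr_eq0 eq_sym (negPf nij).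
have T : j - i = j' - i' by have := congr1 (head 0) E.
have sj w : s (j :: w) = j' :: w.
  by rewrite sE addrCA T addrCA subrr addr0.
suff [k [Gk ku kv]] : exists k, [/\ G k, k (i' :: u) = i' :: u' & k (j' :: v) = j' :: v'].
  exists (k * s)%g; split; first exact: GM.
    by rewrite autM sE addrC subrK.
  by rewrite autM sj.
case: u v u' v' suv su sv {IH T E} => [|x u] [|y v] [|x' u'] [|y' v'] //=.
  by move=> _ _ _; exists 1%g; split.
move=> [suv] [su] [sv].
(* For distinct first letters, [G_pair] aligns both second letters at once. The remaining tails are
   then corrected one after the other, as a branching element for one of the two words fixes
   everything below the first letter of the other. *)
have [k1 [Gk1 k1i k1j]] := G_pair x y x' y' nij'.
have := aut_cat k1 [:: i'; x] u; rewrite k1i => -[u2 /= k1u su2].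
have := aut_cat k1 [:: j'; y] v; rewrite k1j => -[v2 /= k1v sv2].
have [g Mg gu] := M_trans (etrans su2 (esym su)).
have [h Mh hv] : exists2 h, M h & h v2 = v' by apply: M_trans; lia.
have [k2 [Gk2 k2j k2i]] := G_branch x' nij' Mg.
have nji' : j' != i' by rewrite eq_sym.
have [k3 [Gk3 k3i k3j]] := G_branch y' nji' Mh.
exists (k3 * (k2 * k1))%g; split; first exact: GM Gk3 (GM _ _ Gk2 Gk1).
  by rewrite !autM k1u k2i k3i gu.
by rewrite !autM k1v k2j k3j hv.
Qed.

Lemma branch_below w i j x g : i != j -> M g -> exists k,
  [/\ G k, forall u, k (w ++ j :: u) = w ++ j :: u
    & forall u, k (w ++ i :: x :: u) = w ++ i :: x :: g u].
Proof.
move=> nij Mg; elim: w => [|y w [k [Gk kj ki]]]; first exact: G_branch.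
have [k' Gk' kE] := G_lift y Gk.
by exists k'; split=> // u; rewrite /= kE ?kj ?ki.
Qed.

End SelfReplicating.

(** * Words in the states of an automaton *)

Section AutomatonWords.
Variables (d : nat) (Q : eqType) (out : Q -> {perm 'I_d.+2}) (step : Q -> 'I_d.+2 -> Q).
(** [on] and [sn] are the output and transition maps on letters coded by natural numbers, so that
    the tests below can be evaluated. The word [push q w] represents the product of [q] and [w],
    possibly shortened by relations. *)
Variables (on : Q -> nat -> nat) (sn : Q -> nat -> Q) (push : Q -> seq Q -> seq Q).
Implicit Types (w : seq Q) (ws : seq (seq Q)).

Definition word_aut w : tree_aut d.+2 :=
  foldr (fun q g => (automaton_aut out step q * g)%g) 1%g w.

Hypothesis out_on : forall q (i : 'I_d.+2), out q i = on q i :> nat.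
Hypothesis step_sn : forall q (i : 'I_d.+2), step q i = sn q i.
Hypothesis push_aut : forall q w,
  word_aut (push q w) = (automaton_aut out step q * word_aut w)%g.

Definition letter_act w n := foldr on n w.

Fixpoint section_word w n : seq Q :=
  if w is q :: w' then push (sn q (letter_act w' n)) (section_word w' n) else [::].

(** The section of a product $qw$ at $i$ is the section of $q$ at $w(i)$ times the section of $w$ at
    $i$. *)
Lemma word_aut_cons w (i j : 'I_d.+2) u : letter_act w i = j ->
  word_aut w (i :: u) = j :: word_aut (section_word w i) u.
Proof.
elim: w j => [|q w IH] j /=; first by move/val_inj ->.
set n := letter_act w i => qn.
have ln : (n < d.+2)%N.
  rewrite /n; elim: (w) => //= q' w' IHw.
  by have := ltn_ord (out q' (Ordinal IHw)); rewrite out_on.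
rewrite -[LHS]/(automaton_aut out step q (word_aut w (i :: u))).
rewrite (IH (Ordinal ln)) //= push_aut step_sn; congr (_ :: _).
by apply: val_inj; rewrite /= out_on.
Qed.

Lemma word_aut_cat w1 w2 : word_aut (w1 ++ w2) = (word_aut w1 * word_aut w2)%g.
Proof. by elim: w1 => [|q w1 IH] /=; rewrite ?mul1g // IH mulgA. Qed.

Variables (A : seq Q) (B : seq (seq Q)).

(* The tests below ask whether the automorphism given by the word [w] acts below
   the first-level vertex [n] (and [m]) as required by [cert_lift], [cert_pair],
   [cert_branch] and [cert_trans]; they are sufficient conditions only, since
   equality of sections is tested on words reduced by [push]. *)
Definition lift_test n q w := (letter_act w n == n) && (section_word w n == [:: q]).

Definition pair_test n m x y x' y' w :=
  [&& letter_act w n == n, letter_act (section_word w n) x == x',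
      letter_act w m == m & letter_act (section_word w m) y == y'].

Definition branch_test n m x b w :=
  [&& letter_act w m == m, section_word w m == [::],
      letter_act w n == n, letter_act (section_word w n) x == x
    & section_word (section_word w n) x == b].

Definition move_test n m ws := letter_act (flatten ws) n == m.

Definition self_lift_test b ws :=
  (letter_act (flatten ws) 0 == 0%N) && (section_word (flatten ws) 0 == b).

(** Lists of candidate witnesses. [lc], [pc], [bc] hold words in the states [A] generating the
    group, for lifting, for pairs and for branching; [mc], [sc] hold products of the words [B]
    generating $M$, for moving first letters and for lifting below the letter 0. *)
Variables (lc pc bc : seq (seq Q)) (mc sc : seq (seq (seq Q))).

Definition letters := iota 0 d.+2.

Definition certificate :=
  [&& all (all (mem A)) (lc ++ pc ++ bc),
      all (all (mem B)) (mc ++ sc),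
      all (fun n => all (fun q => has (lift_test n q) lc) A) letters,
      all (fun n => all (fun m => (n == m) ||
        all (fun x => all (fun y => all (fun x' => all (fun y' =>
          has (pair_test n m x y x' y') pc) letters) letters) letters) letters)
        letters) letters,
      all (fun n => all (fun m => (n == m) ||
        all (fun x => all (fun b => has (branch_test n m x b) bc) B) letters)
        letters) letters,
      all (fun n => all (fun m => has (move_test n m) mc) letters) letters
    & all (fun b => has (self_lift_test b) sc) B].

Definition state_gens (s : seq Q) : set (tree_aut d.+2) :=
  [set automaton_aut out step q | q in [set` s]].

Definition word_gens (s : seq (seq Q)) : set (tree_aut d.+2) :=
  [set word_aut w | w in [set` s]].

Lemma word_aut_generated w : all (mem A) w -> generated (state_gens A) (word_aut w).
Proof.
have [G1 GM _] := generated_subgroup (state_gens A).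
elim: w => //= q w IH /andP [qA wA]; apply: GM; last exact: IH.
by apply: sub_generated; exists q.
Qed.

Lemma flatten_generated ws :
  all (mem B) ws -> generated (word_gens B) (word_aut (flatten ws)).
Proof.
have [G1 GM _] := generated_subgroup (word_gens B).
elim: ws => //= w ws IH /andP [wB wsB]; rewrite word_aut_cat.
by apply: GM; [apply: sub_generated; exists w | exact: IH].
Qed.

Hypothesis certified : certificate.

Let mem_letters (i : 'I_d.+2) : (i : nat) \in letters.
Proof. by rewrite mem_iota ltn_ord. Qed.

(** The elements that can be lifted below [i] form a subgroup, so witnesses for the generators
    suffice. The same reduction serves for branching. *)
Lemma cert_lift (i : 'I_d.+2) g : generated (state_gens A) g ->
  exists2 k, generated (state_gens A) k & forall u, k (i :: u) = i :: g u.
Proof.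
have [G1 GM GV] := generated_subgroup (state_gens A).
move: g; apply: generated_sub.
  split=> [|g h [k Gk kE] [l Gl lE]|g [k Gk kE]]; first by exists 1%g.
    by exists (k * l)%g => [|u]; rewrite ?autM ?lE ?kE //; exact: GM.
  by exists k^-1%g => [|u]; [exact: GV | apply: (can_inj (autK k)); rewrite kE !autVK].
move=> _ [q qA <-].
case/and5P: certified => cA _ /allP /(_ _ (mem_letters i)) /allP /(_ _ qA) /hasP [w wl].
case/andP => /eqP wi /eqP ws _ _.
move: cA; rewrite !all_cat => /andP [/allP wA _].
exists (word_aut w); first exact: word_aut_generated (wA _ wl).
by move=> u; rewrite (word_aut_cons _ wi) ws.
Qed.

Lemma cert_pair (i j x y x' y' : 'I_d.+2) : i != j ->
  exists k, [/\ generated (state_gens A) k, k [:: i; x] = [:: i; x']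
              & k [:: j; y] = [:: j; y']].
Proof.
move=> nij; case/and5P: certified => cA _ _ + _.
move=> /allP /(_ _ (mem_letters i)) /allP /(_ _ (mem_letters j)).
rewrite (inj_eq val_inj) (negPf nij) orFb.
move=> /allP /(_ _ (mem_letters x)) /allP /(_ _ (mem_letters y)).
move=> /allP /(_ _ (mem_letters x')) /allP /(_ _ (mem_letters y')) /hasP [w wl].
case/and4P => /eqP wi /eqP wx /eqP wj /eqP wy.
move: cA; rewrite !all_cat => /and3P [_ /allP wA _].
exists (word_aut w); split; first exact: word_aut_generated (wA _ wl).
  by rewrite (word_aut_cons _ wi) (word_aut_cons _ wx) aut_nil.
by rewrite (word_aut_cons _ wj) (word_aut_cons _ wy) aut_nil.
Qed.

Lemma cert_branch (i j x : 'I_d.+2) g : i != j -> generated (word_gens B) g ->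
  exists k, [/\ generated (state_gens A) k, forall u, k (j :: u) = j :: u
    & forall u, k (i :: x :: u) = i :: x :: g u].
Proof.
have [G1 GM GV] := generated_subgroup (state_gens A).
move=> nij; move: g; apply: generated_sub.
  split=> [|g h [k [Gk kj kE]] [l [Gl lj lE]]|g [k [Gk kj kE]]].
  - by exists 1%g; split.
  - by exists (k * l)%g; split=> [|u|u]; rewrite ?autM ?lj ?lE ?kj ?kE //; exact: GM.
  - exists k^-1%g; split=> [|u|u]; first exact: GV.
      by rewrite -{1}kj autK.
    by apply: (can_inj (autK k)); rewrite kE !autVK.
move=> _ [b bB <-].
case/and5P: certified => cA _ _ _ /and3P [+ _ _].
move=> /allP /(_ _ (mem_letters i)) /allP /(_ _ (mem_letters j)).
rewrite (inj_eq val_inj) (negPf nij) orFb.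
move=> /allP /(_ _ (mem_letters x)) /allP /(_ _ bB) /hasP [w wl].
case/and5P => /eqP wj /eqP wsj /eqP wi /eqP wx /eqP wb.
move: cA; rewrite !all_cat => /and3P [_ _ /allP wA].
exists (word_aut w); split=> [|u|u]; first exact: word_aut_generated (wA _ wl).
  by rewrite (word_aut_cons _ wj) wsj.
by rewrite (word_aut_cons _ wi) (word_aut_cons _ wx) wb.
Qed.

(** [level_transitive] is applied to the group generated by [B]: the words in [mc] move the first
    letter, and those in [sc] lift the generators below 0 inside that group. *)
Lemma cert_trans (u v : word d.+2) : size u = size v ->
  exists2 g, generated (word_gens B) g & g u = v.
Proof.
have sM := generated_subgroup (word_gens B); have [M1 MM MV] := sM.
case/and5P: certified => _ cB _ _ /and3P [_ mt sl].
move: cB; rewrite all_cat => /andP [/allP mB /allP sB].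
apply: level_transitive => //.
  move=> i j; have := allP (allP mt _ (mem_letters i)) _ (mem_letters j).
  case/hasP => ws /mB /flatten_generated ? /eqP wij.
  by exists (word_aut (flatten ws)); rewrite // (word_aut_cons _ wij) aut_nil.
apply: generated_sub.
  split=> [|g h [k Gk kE] [l Gl lE]|g [k Gk kE]]; first by exists 1%g.
    by exists (k * l)%g => [|w]; rewrite ?autM ?lE ?kE //; exact: MM.
  by exists k^-1%g => [|w]; [exact: MV | apply: (can_inj (autK k)); rewrite kE !autVK].
move=> _ [b bB <-]; case/hasP: (allP sl _ bB) => ws /sB /flatten_generated ?.
case/andP => /eqP w0 /eqP wb; exists (word_aut (flatten ws)) => // w.
by rewrite (@word_aut_cons _ 0 0 _ w0) wb.
Qed.

End AutomatonWords.

(** The common property of the five groups from which both orbit descriptions follow. The fourth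
    clause constrains [k] only below [j] and below [ix]; in the ternary tree the action below the
    third letter is left open. *)
Definition self_replicating_branching d (G : set (tree_aut d.+2)) : Prop :=
  exists M : set (tree_aut d.+2),
  [/\ forall m, exists2 g, G g & forall i u, g (i :: u) = (i + m) :: u,
      forall i g, G g -> exists2 k, G k & forall u, k (i :: u) = i :: g u,
      forall i j x y x' y', i != j -> exists k,
        [/\ G k, k [:: i; x] = [:: i; x'] & k [:: j; y] = [:: j; y']],
      forall i j x g, i != j -> M g -> exists k,
        [/\ G k, forall u, k (j :: u) = j :: u
          & forall u, k (i :: x :: u) = i :: x :: g u]
    & forall u v, size u = size v -> exists2 g, M g & g u = v].

Lemma shift_iter d (G : set (tree_aut d.+2)) a : is_subgroup G -> G a ->
  (forall i u, a (i :: u) = (i + 1) :: u) ->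
  forall m, exists2 g, G g & forall i u, g (i :: u) = (i + m) :: u.
Proof.
move=> [G1 GM _] Ga aE m.
have -> : m = (m : nat)%:R by rewrite natr_Zp.
elim: (m : nat) => [|n [g Gg gE]]; first by exists 1%g => // i u; rewrite addr0.
exists (a * g)%g => [|i u]; first exact: GM.
by rewrite autM gE aE -addrA natr1.
Qed.

(** * The two automata: computation on letters and reduction of words *)

Definition nat_of_state2 q : nat :=
  match q with
  | One2 => 0 | A2 => 1 | B2 => 2 | C2 => 3 | D2 => 4 | Bt2 => 5 | Ct2 => 6 | Dt2 => 7
  end%N.
Lemma nat_of_state2K :
  cancel nat_of_state2 (nth One2 [:: One2; A2; B2; C2; D2; Bt2; Ct2; Dt2]).
Proof. by case. Qed.
HB.instance Definition _ := Equality.copy state2 (can_type nat_of_state2K).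

Definition nat_of_state3 q : nat :=
  match q with One3 => 0 | A3 => 1 | A3inv => 2 | R3 => 3 | S3 => 4 | T3 => 5 end%N.
Lemma nat_of_state3K :
  cancel nat_of_state3 (nth One3 [:: One3; A3; A3inv; R3; S3; T3]).
Proof. by case. Qed.
HB.instance Definition _ := Equality.copy state3 (can_type nat_of_state3K).

Definition on2 (q : state2) n := if q is A2 then (n.+1 %% 2)%N else n.
Definition sn2 (q : state2) (n : nat) : state2 :=
  match q with
  | One2 | A2 => One2
  | B2  => nth One2 [:: A2; C2] n
  | C2  => nth One2 [:: A2; D2] n
  | D2  => nth One2 [:: One2; B2] n
  | Bt2 => nth One2 [:: A2; Ct2] n
  | Ct2 => nth One2 [:: One2; Dt2] n
  | Dt2 => nth One2 [:: One2; Bt2] n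
  end.

Definition on3 (q : state3) n :=
  match q with A3 => (n.+1 %% 3)%N | A3inv => (n.+2 %% 3)%N | _ => n end.
Definition sn3 (q : state3) (n : nat) : state3 :=
  match q with
  | One3 | A3 | A3inv => One3
  | R3 => nth One3 [:: A3; One3; R3] n
  | S3 => nth One3 [:: A3; A3; S3] n
  | T3 => nth One3 [:: A3; A3inv; T3] n
  end.

Lemma out_on2 (q : state2) (i : 'I_2) : out2 q i = on2 q i :> nat.
Proof. by case: q; rewrite /= ?perm1 //= permE /= addn1. Qed.

Lemma out_on3 (q : state3) (i : 'I_3) : out3 q i = on3 q i :> nat.
Proof.
case: q; rewrite /= ?perm1 //; first by rewrite permE /= addn1.
have -> : (Defs.rot 1)^-1%g i = i - 1.
  by apply: (@perm_inj _ (Defs.rot 1)); rewrite permKV permE /= subrK.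
by case: i => -[|[|[|//]]].
Qed.

(** A partial multiplication table: every state is an involution or trivial, and $1,b,c,d$ form a
    Klein four-group. *)
Definition mul2 (q r : state2) : option state2 :=
  if q == r then Some One2 else
  match q, r with
  | One2, s | s, One2 => Some s
  | B2, C2 | C2, B2 => Some D2
  | B2, D2 | D2, B2 => Some C2
  | C2, D2 | D2, C2 => Some B2
  | _, _ => None
  end.

(** Induction on the word: the table is compatible with the outputs, and the sections of the two
    sides are again related by the table. *)
Lemma mul2_aut q r s : mul2 q r = Some s -> (aut2 q * aut2 r)%g = aut2 s.
Proof.
move=> qrs; apply/aut_inj/funext => u /=.
elim: u q r s qrs => //= i u IH q r s qrs; congr (_ :: _).
  apply: ord_inj; rewrite !out_on2; move: qrs.
  by case: q; case: r; case: s; case: i => -[|[|]].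
apply: IH; have -> : step2 q (out2 r i) = sn2 q (on2 r i) by rewrite -out_on2.
by move: qrs; case: q; case: r; case: s; case: i => -[|[|]].
Qed.

(** A state either rotates the first letter and has trivial sections, or fixes the first letter; in
    both cases the sections of its cube are cubes of states. *)
Lemma aut3_cube q u : aut3 q (aut3 q (aut3 q u)) = u.
Proof.
elim: u q => //= i u IH q.
have -> : out3 q (out3 q (out3 q i)) = i.
  by apply: ord_inj; rewrite !out_on3; case: q; case: i => -[|[|[|]]].
have -> : step3 q (out3 q (out3 q i)) = step3 q i by case: q; rewrite /= ?perm1.
have -> : step3 q (out3 q i) = step3 q i by case: q; rewrite /= ?perm1.
by rewrite IH.
Qed.

Definition push2 (q : state2) w :=
  if q == One2 then w else
  if w is r :: w' then
    if mul2 q r is Some s then if s == One2 then w' else s :: w' else q :: w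
  else [:: q].

Definition push3_pos (q : state3) w :=
  if w is r :: r' :: w' then if (q == r) && (q == r') then w' else q :: w
  else q :: w.

(** Writing $a^{-1}$ as $a^2$ leaves the cancellation of cubes as the only reduction. *)
Definition push3 (q : state3) w :=
  match q with
  | One3 => w
  | A3inv => push3_pos A3 (push3_pos A3 w)
  | _ => push3_pos q w
  end.

Lemma push2_aut q w :
  word_aut out2 step2 (push2 q w) = (aut2 q * word_aut out2 step2 w)%g.
Proof.
rewrite /push2; case: eqP => [->|_]; first by rewrite aut2_One mul1g.
case: w => [|r w] //; case qr: (mul2 q r) => [s|] //.
have := mul2_aut qr; case: eqP => [->|_] /= qrE; last by rewrite mulgA qrE.
by rewrite mulgA qrE aut2_One mul1g.
Qed.

Lemma push3_aut q w :
  word_aut out3 step3 (push3 q w) = (aut3 q * word_aut out3 step3 w)%g.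
Proof.
have pos r v : word_aut out3 step3 (push3_pos r v) = (aut3 r * word_aut out3 step3 v)%g.
  case: v => [|r1 [|r2 v]] //=; case: eqP => //= <-; case: eqP => //= <-.
  by apply/aut_inj/funext => u /=; exact/esym/aut3_cube.
rewrite /push3; case: q => //; first by rewrite aut3_One mul1g.
rewrite !pos aut3_Ainv mulgA; congr (_ * _)%g.
apply: (mulgI (aut3 A3)); rewrite mulgV; apply/aut_inj/funext => u.
exact: aut3_cube.
Qed.

Lemma state_gens_seq d (Q : eqType) (out : Q -> {perm 'I_d.+2}) step s :
  state_gens out step s = [set g | g \in map (automaton_aut out step) s].
Proof.
by apply/seteqP; split=> g; [case=> q qs <-; exact: map_f | case/mapP => q; exists q].
Qed.

(* Conjugation by powers of [a] permutes the vertices of the first level, so that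
   witnesses for one vertex provide witnesses for all of them. *)
Definition conj2 (ws : seq (seq state2)) := ws ++ [seq A2 :: rcons w A2 | w <- ws].

Definition conj3 (ws : seq (seq state3)) :=
  ws ++ [seq A3 :: w ++ [:: A3; A3] | w <- ws] ++
        [seq A3 :: A3 :: rcons w A3 | w <- ws].

Lemma branching2 A B lc pc bc mc sc : A2 \in A ->
  certificate 0 on2 sn2 push2 A B lc pc bc mc sc ->
  self_replicating_branching (generated (state_gens out2 step2 A)).
Proof.
move=> A2A cert; exists (generated (word_gens out2 step2 B)); split.
- apply: (shift_iter (a := aut2 A2)); first exact: generated_subgroup.
    by apply: sub_generated; exists A2.
  move=> i u; rewrite -[LHS]/(out2 A2 i :: aut2 One2 u) aut2_One.
  by rewrite permE.
- exact: (cert_lift out_on2 (fun q i => erefl) push2_aut cert).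
- exact: (cert_pair out_on2 (fun q i => erefl) push2_aut cert).
- exact: (cert_branch out_on2 (fun q i => erefl) push2_aut cert).
- exact: (cert_trans out_on2 (fun q i => erefl) push2_aut cert).
Qed.

Lemma branching3 A B lc pc bc mc sc : A3 \in A ->
  certificate 1 on3 sn3 push3 A B lc pc bc mc sc ->
  self_replicating_branching (generated (state_gens out3 step3 A)).
Proof.
move=> A3A cert; exists (generated (word_gens out3 step3 B)); split.
- apply: (shift_iter (a := aut3 A3) _ _ aut3_A); first exact: generated_subgroup.
  by apply: sub_generated; exists A3.
- exact: (cert_lift out_on3 (fun q i => erefl) push3_aut cert).
- exact: (cert_pair out_on3 (fun q i => erefl) push3_aut cert).
- exact: (cert_branch out_on3 (fun q i => erefl) push3_aut cert).
- exact: (cert_trans out_on3 (fun q i => erefl) push3_aut cert).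
Qed.

(** * Witnesses for the five groups *)

Section Grigorchuk.
Local Notation a := A2.
Local Notation b := B2.
Local Notation c := C2.
Local Notation d := D2.
(** As $\psi(ada)=(b,1)$, all conjugates of $ada$ by words in $a,b$ are trivial below one letter.
    From $\psi(b)=(a,c)$, suitable ones have the sections $a$, $c$, $dad$ two levels down. *)
Lemma grigorchuk_branching : self_replicating_branching (generated grigorchuk_gens).
Proof.
have -> : grigorchuk_gens = state_gens out2 step2 [:: a; b; c; d].
  by rewrite state_gens_seq.
apply: (branching2 (B :=
  [:: [:: a]; [:: c]; [:: d; a; d]])
  (lc := (conj2 [:: [:: b]; [:: a; b; a]; [:: a; c; a]; [:: a; d; a]]))
  (pc := (conj2 [:: [::]; [:: b]; [:: a; b; a]; [:: b; a; b; a]]))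
  (bc := (conj2 [:: [:: a; d; a]; [:: b; a; d; a; b];
    [:: a; b; a; b; a; d; a; b; a; b; a];
    [:: b; a; b; a; b; a; d; a; b; a; b; a; b]]))
  (mc := [:: [::]; [:: [:: a]]])
  (sc := [:: [:: [:: c]]; [:: [:: a]; [:: c]; [:: d; a; d]]; [:: [:: a]; [:: c];
    [:: a]; [:: c]; [:: a]; [:: c]; [:: a]]])).
  by [].
by vm_compute.
Qed.
End Grigorchuk.

Section GrigorchukTilde.
Local Notation a := A2.
Local Notation b := Bt2.
Local Notation c := Ct2.
Local Notation d := Dt2.
(** Here $\psi(aca)=(d,1)$ and $\psi(d)=(1,b)$, so $aca$ and its conjugate by $b$ provide the
    further generator $b$ of $M$. *)
Lemma grigorchuk_tilde_branching : self_replicating_branching (generated grigorchuk_tilde_gens).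
Proof.
have -> : grigorchuk_tilde_gens = state_gens out2 step2 [:: a; b; c; d].
  by rewrite state_gens_seq.
apply: (branching2 (B :=
  [:: [:: a]; [:: b]; [:: c]; [:: d; a; d]])
  (lc := (conj2 [:: [:: b]; [:: a; b; a]; [:: a; c; a]; [:: a; d; a]]))
  (pc := (conj2 [:: [::]; [:: b]; [:: a; b; a]; [:: b; a; b; a]]))
  (bc := (conj2 [:: [:: a; c; a]; [:: a; d; a]; [:: b; a; d; a; b];
    [:: b; a; c; a; b]; [:: a; b; a; b; a; d; a; b; a; b; a];
    [:: b; a; b; a; b; a; d; a; b; a; b; a; b]]))
  (mc := [:: [::]; [:: [:: a]]])
  (sc := [:: [:: [:: b]]; [:: [:: a]; [:: d; a; d]]; [:: [:: a]; [:: c]; [:: a]];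
    [:: [:: a]; [:: b]; [:: a]]; [:: [:: a]; [:: c]; [:: a]; [:: b]; [:: a]; [:: c];
    [:: a]]])).
  by [].
by vm_compute.
Qed.
End GrigorchukTilde.

Section Gamma.
Local Notation a := A3.
Local Notation r := R3.
(** $M$ is the whole group. Already $\psi(ara^{-1})=(r,a,1)$ is trivial below one letter, and
    conjugation by $r$ moves the sections of its first component among the letters $x$. *)
Lemma Gamma_branching : self_replicating_branching (generated Gamma_gens).
Proof.
have -> : Gamma_gens = state_gens out3 step3 [:: a; r].
  by rewrite state_gens_seq.
apply: (branching3 (B :=
  [:: [:: a]; [:: r]])
  (lc := (conj3 [:: [:: r]; [:: a; r; a; a]]))
  (pc := (conj3 [:: [::]; [:: r]; [:: r; r]; [:: a; a; r; a]; [:: a; r; a; a];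
    [:: r; a; r; a; a]; [:: a; a; r; r; a]; [:: a; r; r; a; a]; [:: r; a; a; r; a];
    [:: r; r; a; r; a; a]; [:: r; r; a; a; r; a]; [:: r; a; a; r; r; a];
    [:: r; a; r; r; a; a]; [:: r; r; a; a; r; r; a]; [:: r; r; a; r; r; a; a]]))
  (bc := (conj3 [:: [:: a; r; a; a]; [:: r; a; r; a; a; r; r];
    [:: r; r; a; r; a; a; r]; [:: r; a; r; a; a; r; a; r; r; a; a; r];
    [:: r; a; r; a; a; r; r; a; r; r; a; a];
    [:: r; r; a; r; a; a; r; a; r; r; a; a];
    [:: r; a; r; r; a; a; r; r; a; r; a; a];
    [:: r; a; r; r; a; a; r; a; r; a; a; r];
    [:: r; r; a; r; r; a; a; r; a; r; a; a]]))
  (mc := [:: [::]; [:: [:: a]]; [:: [:: a]; [:: a]]])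
  (sc := [:: [:: [:: r]]; [:: [:: a]; [:: r]; [:: a]; [:: a]]])).
  by [].
by vm_compute.
Qed.
End Gamma.

(* [M] cannot be the whole group here: an element that fixes the subtrees below
   [i] and [j] setwise and is trivial below [j] has below [i] a section of total
   exponent divisible by 3 in [a] and [r]. *)
Section GammaBar.
Local Notation a := A3.
Local Notation r := S3.
Lemma Gamma_bar_branching : self_replicating_branching (generated Gamma_bar_gens).
Proof.
have -> : Gamma_bar_gens = state_gens out3 step3 [:: a; r].
  by rewrite state_gens_seq.
apply: (branching3 (B :=
  [:: [:: a; a; r]; [:: a; r; a]; [:: r; a; a]])
  (lc := (conj3 [:: [:: r]; [:: a; r; a; a]]))
  (pc := (conj3 [:: [::]; [:: r]; [:: r; r]; [:: a; a; r; a]; [:: a; r; a; a];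
    [:: a; a; r; r; a]; [:: r; a; r; a; a]; [:: a; r; a; r; a]; [:: a; r; r; a; a];
    [:: r; a; a; r; a]]))
  (bc := (conj3 [:: [:: a; r; r; a; r; a; a; r; a; r; r; a];
    [:: a; r; r; a; r; r; a; a; r; a; r; a];
    [:: a; r; a; r; r; a; a; r; r; a; r; a];
    [:: r; a; r; r; a; a; r; a; r; a; a; r];
    [:: a; r; a; a; r; r; a; r; r; a; a; r];
    [:: r; r; a; r; r; a; a; r; a; r; a; a];
    [:: a; r; r; a; a; r; a; r; a; a; r; r];
    [:: r; r; a; r; a; a; r; a; r; r; a; a];
    [:: r; a; r; a; a; r; r; a; r; r; a; a];
    [:: a; r; a; r; a; a; r; a; r; r; a; a; r; a; a];
    [:: a; a; r; a; a; r; a; r; r; a; a; r; r; a; a];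
    [:: r; a; r; a; a; r; a; r; a; a; r; a; r; a; a];
    [:: a; a; r; r; a; a; r; a; r; a; a; r; r; a; a];
    [:: a; r; a; a; r; a; r; a; a; r; r; a; r; a; a];
    [:: a; a; r; r; a; a; r; r; a; r; a; a; r; a; a];
    [:: a; r; a; r; r; a; a; r; a; r; a; a; r; a; a];
    [:: r; r; a; r; a; r; a; a; r; a; a; r; a; r; a; r; r; a]]))
  (mc := [:: [::]; [:: [:: a; a; r]]; [:: [:: a; a; r]; [:: a; a; r]]])
  (sc := [:: [:: [:: a; a; r]; [:: a; a; r]; [:: a; a; r]]; [:: [:: a; a; r];
    [:: a; r; a]; [:: r; a; a]]; [:: [:: a; r; a]; [:: a; r; a]; [:: a; a; r]]])).
  by [].
by vm_compute.
Qed.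
End GammaBar.

Section GammaBarBar.
Local Notation a := A3.
Local Notation r := T3.
(** $M$ is the whole group. No section of $r$ at the first level is trivial, so the branching
    witnesses are longer products whose sections below [j] cancel. *)
Lemma Gamma_bar_bar_branching : self_replicating_branching (generated Gamma_bar_bar_gens).
Proof.
have -> : Gamma_bar_bar_gens = state_gens out3 step3 [:: a; r].
  by rewrite state_gens_seq.
apply: (branching3 (B :=
  [:: [:: a]; [:: r]])
  (lc := (conj3 [:: [:: r]; [:: a; r; a; a]]))
  (pc := (conj3 [:: [::]; [:: r]; [:: r; r]; [:: a; a; r; a]; [:: a; r; a; a];
    [:: r; a; r; a; a]; [:: a; r; r; a; a]; [:: r; r; a; r; a; a];
    [:: r; a; r; r; a; a]]))
  (bc := (conj3 [:: [:: a; r; a; r; r; a; a; r; r; a; r; a];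
    [:: r; r; a; r; a; a; r; a; r; r; a; a];
    [:: r; a; r; r; a; a; r; r; a; r; a; a];
    [:: a; r; r; a; r; a; a; r; a; r; r; a];
    [:: r; a; r; a; a; r; a; r; r; a; a; r];
    [:: a; r; a; a; r; a; r; a; a; r; a; r; a; a; r];
    [:: r; a; r; a; a; r; a; r; a; a; r; a; r; a; a];
    [:: a; a; r; a; a; r; r; a; r; a; a; r; a; r; a];
    [:: a; r; a; r; a; a; r; a; r; a; a; r; a; r; a];
    [:: a; a; r; a; a; r; a; r; a; a; r; a; r; a; a; r; a; a]]))
  (mc := [:: [::]; [:: [:: a]]; [:: [:: a]; [:: a]]])
  (sc := [:: [:: [:: r]]; [:: [:: a]; [:: r]; [:: a]; [:: a]]])).
  by [].
by vm_compute.
Qed.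
End GammaBarBar.

(** * The Hilbert space l^2 *)

Section HilbertSpace.
Variables (R : realType) (T : choiceType).
Implicit Types (f g h : l2 R T) (c : R[i]).

Definition sqnorm f : R := fine (sqsum f).

Lemma sqnormE f : (sqnorm f)%:E = sqsum f.
Proof. by rewrite /sqnorm fineK // sqsum_fin. Qed.

Lemma sqnorm_ge0 f : 0 <= sqnorm f.
Proof. by rewrite -lee_fin sqnormE sqsum_ge0. Qed.

Lemma l2_normE f : `|f| = (Num.sqrt (sqnorm f))%:C.
Proof. by []. Qed.

Lemma sqnorm_eq0 f : sqnorm f = 0 -> f = 0.
Proof. by move=> f0; apply/normr0_eq0; rewrite l2_normE f0 sqrtr0. Qed.

Lemma sqnorm0 : sqnorm 0 = 0.
Proof.
apply: EFin_inj; rewrite sqnormE; apply: esum1 => x _.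
by rewrite /normc2 /= expr0n addr0.
Qed.

Lemma sqnormZ c f : sqnorm (c *: f) = normc2 c * sqnorm f.
Proof. by apply: EFin_inj; rewrite EFinM !sqnormE -sqsumZ. Qed.

Lemma sqnormN f : sqnorm (- f) = sqnorm f.
Proof. by rewrite -scaleN1r sqnormZ /normc2 /= oppr0 expr0n addr0 sqrrN expr1n mul1r. Qed.

Lemma sqnormB f g : sqnorm (f - g) = sqnorm (g - f).
Proof. by rewrite -sqnormN opprB. Qed.

Lemma parallelogram f g :
  sqnorm (f + g) + sqnorm (f - g) = 2 * sqnorm f + 2 * sqnorm g.
Proof.
apply: EFin_inj; rewrite !mulrDl !mul1r !EFinD !sqnormE /sqsum.
rewrite -!esumD; try by move=> x _; rewrite ?adde_ge0 ?lee_fin ?normc2_ge0.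
apply: eq_esum => x _; rewrite -!EFinD; congr EFin.
have -> : (f + g) x = f x + g x by [].
have -> : (f - g) x = f x - g x by [].
by case: (l2_val f x) (l2_val g x) => [a b] [c d]; rewrite /normc2 /=; ring.
Qed.

(* Jordan-von Neumann: the real polarization of the norm is biadditive. *)
Lemma polarD f g h :
  sqnorm (f + g + h) = sqnorm (f + g) + sqnorm (f + h) + sqnorm (g + h)
    - sqnorm f - sqnorm g - sqnorm h.
Proof.
have p2 := parallelogram (f + h) g.
have p3 := parallelogram (g + h) f.
have p4 := parallelogram (f - g) h.
have p5 := parallelogram f g.
have e1 : f + h + g = f + g + h by rewrite addrAC.
have e2 : g + h + f = f + g + h by rewrite addrC addrA.
have e3 : f + h - g = f - g + h by rewrite addrAC.
have e4 : sqnorm (g + h - f) = sqnorm (f - g - h) by rewrite sqnormB opprD addrA.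
move: p2 p3 p4 p5; rewrite e1 e2 e3 e4.
move: (sqnorm (f + g + h)) (sqnorm (f + g)) (sqnorm (f + h)) (sqnorm (g + h)).
move: (sqnorm (f - g + h)) (sqnorm (f - g - h)) (sqnorm (f - g)).
move: (sqnorm f) (sqnorm g) (sqnorm h) => *; lra.
Qed.

Lemma normc2_le_sqnorm f x : normc2 (f x) <= sqnorm f.
Proof.
rewrite -lee_fin sqnormE; apply: esum_ge.
by exists [set x] => //; rewrite fsbig_set1.
Qed.

Lemma sum_le_sqnorm f (s : seq T) : uniq s ->
  \sum_(x <- s) normc2 (f x) <= sqnorm f.
Proof.
move=> us; rewrite -lee_fin sqnormE; apply: esum_ge; exists [set` s].
  by split=> //; exact: finite_seq.
by rewrite fsumEFin ?lee_fin -?fsbig_seq //; exact: finite_seq.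
Qed.

Lemma sqsum_le (f : T -> R[i]^o) (M : R) :
  (forall s : seq T, uniq s -> \sum_(x <- s) normc2 (f x) <= M) ->
  (sqsum f <= M%:E)%E.
Proof.
move=> fM; apply: ub_ereal_sup => _ [A [finA _] <-].
by rewrite fsbig_finite //= sumEFin lee_fin fM.
Qed.

Lemma sqnormD_le f g : sqnorm (f + g) <= 2 * sqnorm f + 2 * sqnorm g.
Proof. by rewrite -parallelogram lerDl sqnorm_ge0. Qed.

Lemma cauchy_real (a : nat -> R) :
  (forall e, 0 < e -> exists n, forall m k, (n <= m)%N -> (n <= k)%N -> `|a m - a k| <= e) ->
  cvgn a.
Proof.
move=> aC; apply/cauchy_cvgP/cauchyP => e e0.
have [n nP] := aC (e / 2) ltac:(by rewrite divr_gt0).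
exists (a n); exists n => // k /= nk; rewrite -ball_normE /=.
by apply: le_lt_trans (nP n k (leqnn n) nk) _; lra.
Qed.

(** The coordinates converge, and bounds on finite sums of squared differences pass to the limit;
    this yields both square summability of the limit and convergence in norm. *)
Lemma l2_complete (u : nat -> l2 R T) :
  (forall e, 0 < e -> exists n, forall m k, (n <= m)%N -> (n <= k)%N ->
     sqnorm (u m - u k) <= e) ->
  exists p, forall e, 0 < e -> exists n, forall m, (n <= m)%N -> sqnorm (u m - p) <= e.
Proof.
move=> uC.
pose a x n := complex.Re (u n x); pose b x n := complex.Im (u n x).
have subE m k x : normc2 (u m x - u k x) = (a x m - a x k) ^+ 2 + (b x m - b x k) ^+ 2.
  by rewrite /a /b; case: (u m x) (u k x) => [? ?] [? ?].
have ab_le m k x : normc2 (u m x - u k x) <= sqnorm (u m - u k).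
  exact: (normc2_le_sqnorm (u m - u k)).
have sqr_le (r e : R) : 0 < e -> r ^+ 2 <= e ^+ 2 -> `|r| <= e.
  by move=> e0; rewrite -(real_normK (num_real r)) ler_pXn2r // nnegrE ?normr_ge0 ?ltW.
have ca x : cvgn (a x).
  apply: cauchy_real => e e0; have [n nP] := uC _ (exprn_gt0 2 e0).
  exists n => m k nm nk; apply: sqr_le => //; apply: le_trans (nP _ _ nm nk).
  by apply: le_trans (ab_le _ _ x); rewrite subE lerDl sqr_ge0.
have cb x : cvgn (b x).
  apply: cauchy_real => e e0; have [n nP] := uC _ (exprn_gt0 2 e0).
  exists n => m k nm nk; apply: sqr_le => //; apply: le_trans (nP _ _ nm nk).
  by apply: le_trans (ab_le _ _ x); rewrite subE lerDr sqr_ge0.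
pose p0 : T -> R[i]^o := fun x => (limn (a x) +i* limn (b x))%C.
have key m n e : (forall k, (n <= k)%N -> sqnorm (u m - u k) <= e) ->
    (sqsum (fun x => (u m x - p0 x)%R : R[i]^o) <= e%:E)%E.
  move=> mP; apply: sqsum_le => s us.
  have -> : \sum_(x <- s) normc2 (u m x - p0 x) =
      \sum_(x <- s) ((a x m - limn (a x)) ^+ 2 + (b x m - limn (b x)) ^+ 2).
    by apply: eq_bigr => x _; rewrite /a /b /p0; case: (u m x).
  have C : (\sum_(x <- s) ((a x m - a x k) ^+ 2 + (b x m - b x k) ^+ 2)) @[k --> \oo]
      --> \sum_(x <- s) ((a x m - limn (a x)) ^+ 2 + (b x m - limn (b x)) ^+ 2).
    apply: cvg_big => [|x _]; first exact: add_continuous.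
    apply: cvgD.
      by apply: cvgM; apply: cvgB; [exact: cvg_cst|exact: ca|exact: cvg_cst|exact: ca].
    by apply: cvgM; apply: cvgB; [exact: cvg_cst|exact: cb|exact: cvg_cst|exact: cb].
  apply: (cvgr_to_le C); exists n => // k /= nk; apply: le_trans (mP k nk).
  apply: le_trans (sum_le_sqnorm (u m - u k) us).
  by rewrite le_eqVlt; apply/orP; left; apply/eqP/eq_bigr => x _; rewrite -subE.
have [n0 n0P] := uC 1 ltr01.
have wS : square_summable (fun x => u n0 x - p0 x : R[i]^o).
  rewrite /square_summable /=; apply: le_lt_trans (ltry 1).
  by apply: (key _ n0) => k; exact: n0P.
(* The coordinatewise limit [p0], written as a difference of two square-summable functions. *)
exists (u n0 - L2 wS) => e e0; have [n nP] := uC e e0.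
exists n => m nm; rewrite -lee_fin sqnormE.
have <- : sqsum (fun x => u m x - p0 x : R[i]^o) = sqsum (u m - (u n0 - L2 wS)).
  apply: eq_esum => x _; congr (_%:E); congr normc2.
  have -> : (u m - (u n0 - L2 wS)) x = u m x - (u n0 x - (u n0 x - p0 x)) by [].
  by rewrite subKr.
by apply: (key _ n) => k; exact: nP.
Qed.

Lemma closed_sqnorm (V : set (l2 R T)) p : closed V ->
  (forall e, 0 < e -> exists2 f, V f & sqnorm (p - f) <= e) -> V p.
Proof.
move=> cV pV; apply: cV => B /nbhs_ballP [e e0 eB].
(* A positive element of [R[i]] is real, so the radius of the ball is a real number. *)
have eE : e = (complex.Re e)%:C.
  by case: e e0 {eB} => x y /= ; rewrite ltcE /= => /andP [/eqP ->].
have r0 : 0 < complex.Re e by rewrite -ltcR -eE.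
have [f Vf fe] := pV _ (exprn_gt0 2 (divr_gt0 r0 (ltr0Sn R 1))).
exists f; split=> //; apply: eB; rewrite -ball_normE /= l2_normE eE ltcR /=.
have : Num.sqrt (sqnorm (p - f)) <= complex.Re e / 2.
  have -> : complex.Re e / 2 = Num.sqrt ((complex.Re e / 2) ^+ 2).
    by rewrite sqrtr_sqr ger0_norm // divr_ge0 // ltW.
  exact: ler_wsqrtr.
by move=> /le_lt_trans; apply; lra.
Qed.

Lemma sqnorm_closed (V : set (l2 R T)) :
  (forall p, (forall e, 0 < e -> exists2 f, V f & sqnorm (p - f) <= e) -> V p) ->
  closed V.
Proof.
move=> VP p pV; apply: VP => e e0.
have [] := pV (ball p (Num.sqrt e)%:C).
  by apply: nbhsx_ballx; rewrite ltcR sqrtr_gt0.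
move=> f [Vf]; rewrite -ball_normE /= l2_normE ltcR => fe; exists f => //.
by rewrite -ler_sqrt ?ltW.
Qed.

End HilbertSpace.

(** * Orthogonal projection onto a closed subspace *)

Section Projection.
Variables (R : realType) (T : choiceType) (V : set (l2 R T)).
Implicit Types (f g h p : l2 R T) (c : R[i]).
Hypothesis V0 : V 0.
Hypothesis VL : forall c f g, V f -> V g -> V (c *: f + g).
Hypothesis Vclosed : closed V.

Let VZ c f : V f -> V (c *: f).
Proof. by move=> Vf; rewrite -[_ *: _]addr0; exact: VL. Qed.

Let VD f g : V f -> V g -> V (f + g).
Proof. by move=> Vf Vg; rewrite -[f]scale1r; exact: VL. Qed.

Let VB f g : V f -> V g -> V (f - g).
Proof. by move=> Vf Vg; rewrite addrC -scaleN1r; exact: VL. Qed.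

Lemma normc2_real (r : R) : normc2 r%:C = r ^+ 2.
Proof. by rewrite /normc2 /= expr0n addr0. Qed.

(** Orthogonality expressed by Pythagoras' identity, that is, by the vanishing of the real part of
    the inner product; for a complex subspace this is full orthogonality. *)
Definition orth g : Prop := forall v, V v -> sqnorm (g + v) = sqnorm g + sqnorm v.

Lemma orthZ c g : orth g -> orth (c *: g).
Proof.
move=> og v Vv; have [->|c0] := eqVneq c 0.
  by rewrite scale0r add0r sqnorm0 add0r.
have vE : v = c *: (c^-1 *: v) by rewrite scalerA divff // scale1r.
have -> : c *: g + v = c *: (g + c^-1 *: v) by rewrite scalerDr -vE.
by rewrite sqnormZ (og _ (VZ _ Vv)) mulrDr -!sqnormZ -vE.
Qed.

Lemma orthD g h : orth g -> orth h -> orth (g + h).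
Proof.
move=> og oh v Vv; rewrite polarD (og _ Vv) (oh _ Vv).
move: (sqnorm (g + h)) (sqnorm g) (sqnorm h) (sqnorm v) => *; lra.
Qed.

(* [B w], the real inner product of [g] and [w] up to a factor 2, is additive
   in [w], and minimality at [w = v / n] gives [n B v + |v|^2 >= 0] for all n. *)
Lemma minimal_orth g : (forall v, V v -> sqnorm g <= sqnorm (g + v)) -> orth g.
Proof.
move=> gmin; pose B w := sqnorm (g + w) - sqnorm g - sqnorm w.
have BD v w : B (v + w) = B v + B w.
  rewrite /B addrA polarD.
  move: (sqnorm (g + v)) (sqnorm (g + w)) (sqnorm (v + w)) => *.
  by move: (sqnorm g) (sqnorm v) (sqnorm w) => *; lra.
have B0 : B 0 = 0 by rewrite /B addr0 sqnorm0; lra.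
have Bn w n : B (w *+ n) = B w *+ n.
  by elim: n => [|n IH]; rewrite ?mulr0n // !mulrS BD IH.
have Bge v : V v -> 0 <= B v.
  move=> Vv; apply/ler_addgt0Pr => e e0.
  have [n nv] : exists n : nat, sqnorm v / n.+1%:R <= e.
    exists (Num.bound (sqnorm v / e)); rewrite ler_pdivrMr ?ltr0n //.
    have ve : 0 <= sqnorm v / e by rewrite divr_ge0 ?sqnorm_ge0 // ltW.
    have := archi_boundP ve; rewrite ltr_pdivrMr // mulrC => /ltW /le_trans; apply.
    by rewrite ler_pM2l // ler_nat.
  pose w := (n.+1%:R^-1 : R)%:C *: v.
  have vw : v = w *+ n.+1.
    rewrite -scaler_nat scalerA -(rmorph_nat (real_complex R)) -rmorphM divff ?pnatr_eq0 //.
    by rewrite scale1r.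
  have := gmin w (VZ _ Vv).
  have wv : sqnorm w = sqnorm v / n.+1%:R ^+ 2.
    by rewrite sqnormZ normc2_real exprVn mulrC.
  have -> : sqnorm (g + w) = B w + sqnorm g + sqnorm w by rewrite /B; lra.
  rewrite {1}vw Bn -mulr_natl wv => H.
  have n0 : 0 < n.+1%:R :> R by rewrite ltr0n.
  have Hw : 0 <= B w + sqnorm v / n.+1%:R ^+ 2.
    by move: H; move: (B w) (sqnorm g) (sqnorm v / _) => *; lra.
  have := mulr_ge0 (ltW n0) Hw; rewrite mulrDr.
  have -> : n.+1%:R * (sqnorm v / n.+1%:R ^+ 2) = sqnorm v / n.+1%:R.
    by field; rewrite gt_eqF.
  by move: nv; move: (_ * B w) (sqnorm v / _) => *; lra.
move=> v Vv; have := Bge v Vv; have := Bge (- v); rewrite -scaleN1r => /(_ (VZ _ Vv)).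
have := BD v (-1 *: v); rewrite scaleN1r subrr B0.
have : B v = sqnorm (g + v) - sqnorm g - sqnorm v by [].
move: (B v) (B (- v)) (sqnorm (g + v)) (sqnorm g) (sqnorm v) => *; lra.
Qed.

(** A minimizing sequence for the distance from [f] to [V] is Cauchy; its limit lies in [V], attains
    the infimum, and is therefore the foot of the perpendicular. *)
Lemma projection_ex f : exists p, V p /\ orth (f - p).
Proof.
pose S := [set sqnorm (f - v) | v in V].
have infS : has_inf S.
  split; first by exists (sqnorm (f - 0)), 0.
  by exists 0 => _ [v _ <-]; exact: sqnorm_ge0.
pose D := inf S.
have Dle v : V v -> D <= sqnorm (f - v).
  by move=> Vv; apply: ge_inf; [exact: infS.2 | exists v].
have D0 : 0 <= D by apply: lb_le_inf; [exact: infS.1 | move=> _ [v _ <-]; exact: sqnorm_ge0].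
have Dapp e : 0 < e -> exists2 v, V v & sqnorm (f - v) <= D + e.
  by move=> e0; have [_ [v Vv <-] ve] := inf_adherent e0 infS; exists v => //; exact: ltW.
(* The parallelogram identity for [f - v] and [f - w], whose sum is twice the vector from the
   midpoint of [v] and [w] to [f]. *)
have close e v w : V v -> V w -> sqnorm (f - v) <= D + e -> sqnorm (f - w) <= D + e ->
    sqnorm (v - w) <= 4 * e.
  move=> Vv Vw ve we.
  have := parallelogram (f - v) (f - w).
  have -> : f - v - (f - w) = w - v by rewrite opprB addrC addrA subrK.
  have -> : f - v + (f - w) = (2 : R)%:C *: (f - (2^-1 : R)%:C *: (v + w)).
    rewrite scalerBr scalerA -rmorphM divff ?pnatr_eq0 // scale1r.
    by rewrite rmorph_nat scaler_nat mulr2n opprD addrACA.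
  rewrite sqnormZ normc2_real (sqnormB w).
  have := Dle _ (VZ (2^-1 : R)%:C (VD Vv Vw)).
  by move: (sqnorm (v - w)) (sqnorm (f - _)) (sqnorm (f - v)) (sqnorm (f - w)) ve we => *; lra.
pose ev n : R := n.+1%:R^-1.
have ev0 n : 0 < ev n by rewrite invr_gt0 ltr0n.
pose u n := projT1 (cid2 (Dapp _ (ev0 n))).
have uV n : V (u n) by rewrite /u; case: cid2.
have uD n : sqnorm (f - u n) <= D + ev n by rewrite /u; case: cid2.
have ev_small e : 0 < e -> exists n, forall m, (n <= m)%N -> ev m <= e.
  move=> e0; exists (Num.bound e^-1) => m nm.
  rewrite -[leRHS]invrK lef_pV2 ?posrE ?invr_gt0 ?ltr0n //.
  have ie : 0 <= e^-1 by rewrite invr_ge0 ltW.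
  apply: le_trans (ltW (archi_boundP ie)) _.
  by rewrite ler_nat ltnW.
have [|p pP] := @l2_complete R T u.
  move=> e e0; have [n nP] := ev_small (e / 4) ltac:(by rewrite divr_gt0).
  exists n => m k nm nk; have -> : e = 4 * (e / 4) by lra.
  by apply: close => //; apply: le_trans (uD _) _; rewrite lerD2l nP.
exists p; split.
  apply: (closed_sqnorm Vclosed) => e e0; have [n nP] := pP e e0.
  by exists (u n) => //; rewrite sqnormB nP.
have pV : V p.
  apply: (closed_sqnorm Vclosed) => e e0; have [n nP] := pP e e0.
  by exists (u n) => //; rewrite sqnormB nP.
apply: minimal_orth => v Vv.
suff pD : sqnorm (f - p) <= D.
  apply: le_trans pD _; have -> : f - p + v = f - (p - v) by rewrite opprB addrA addrAC.
  by apply: Dle; exact: VB.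
have wD s d : 0 < s -> 0 < d ->
    sqnorm (f - p) <= (1 + s) * (D + d) + (1 + s^-1) * d.
  move=> s0 d0; have [n1 n1P] := ev_small d d0; have [n2 n2P] := pP d d0.
  pose n := maxn n1 n2.
  have -> : f - p = (f - u n) + (u n - p) by rewrite addrA subrK.
  rewrite -lee_fin sqnormE; apply: le_trans (sqsumD _ _ s0) _.
  rewrite -!sqnormE -!EFinM -EFinD lee_fin lerD // ler_wpM2l //.
  - by rewrite addr_ge0 // ltW.
  - by apply: le_trans (uD _) _; rewrite lerD2l n1P // leq_maxl.
  - by rewrite addr_ge0 // invr_ge0 ltW.
  - by rewrite n2P // leq_maxr.
apply/ler_addgt0Pr => e e0.
(* This [s] makes $sD\le e/2$, with $D+1$ in place of $D$ because $D$ may vanish. With $d=e/(2M)$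
   the bound of [wD] equals $D+sD+e/2$. *)
pose s := e / (2 * (D + 1)); have s0 : 0 < s by rewrite divr_gt0 // mulr_gt0 // ltr_wpDl.
pose M := 2 + s + s^-1.
have M0 : 0 < M by rewrite /M !addr_gt0 // invr_gt0.
have := wD s (e / (2 * M)) s0 (divr_gt0 e0 (mulr_gt0 (ltr0Sn R 1) M0)).
have -> : (1 + s) * (D + e / (2 * M)) + (1 + s^-1) * (e / (2 * M)) =
    D + s * D + M * (e / (2 * M)) by rewrite /M; ring.
have -> : M * (e / (2 * M)) = e / 2 by field; rewrite gt_eqF.
have : s * D <= e / 2.
  have D1 : 0 < D + 1 by rewrite ltr_wpDl.
  have -> : s * D = e / 2 * (D / (D + 1)) by rewrite /s; field; rewrite gt_eqF.
  apply: ler_piMr; first by rewrite divr_ge0 // ltW.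
  by rewrite ler_pdivrMr // mul1r lerDl.
by move: (sqnorm _) (s * D) => *; lra.
Qed.

Definition orth_proj f := projT1 (cid (projection_ex f)).

Lemma orth_proj_in f : V (orth_proj f).
Proof. by rewrite /orth_proj; case: cid => p []. Qed.

Lemma orth_projP f : orth (f - orth_proj f).
Proof. by rewrite /orth_proj; case: cid => p []. Qed.

(** Pythagoras' identity from each of the two candidates to the other shows that twice their squared
    distance is 0. *)
Lemma orth_proj_unique f p : V p -> orth (f - p) -> orth_proj f = p.
Proof.
move=> Vp op; apply/eqP; rewrite -subr_eq0; apply/eqP/sqnorm_eq0.
have e1 := op _ (VB Vp (orth_proj_in f)).
have e2 := @orth_projP f _ (VB (orth_proj_in f) Vp).
move: e1 e2; rewrite !addrA !subrK (sqnormB p).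
by move: (sqnorm (orth_proj f - p)) => *; lra.
Qed.

Lemma orth_proj_id f : V f -> orth_proj f = f.
Proof.
move=> Vf; apply: orth_proj_unique => // v Vv.
by rewrite subrr add0r sqnorm0 add0r.
Qed.

Lemma orth_proj_linear c f g : orth_proj (c *: f + g) = c *: orth_proj f + orth_proj g.
Proof.
apply: orth_proj_unique; first by apply: VL; exact: orth_proj_in.
have -> : c *: f + g - (c *: orth_proj f + orth_proj g) = c *: (f - orth_proj f) + (g - orth_proj g).
  by rewrite scalerBr opprD addrACA.
by apply: orthD; [apply: orthZ|]; exact: orth_projP.
Qed.

Lemma orth_proj_le f : sqnorm (orth_proj f) <= sqnorm f.
Proof.
by rewrite -{2}(subrK (orth_proj f) f) (@orth_projP f _ (orth_proj_in f)) lerDr sqnorm_ge0.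
Qed.

End Projection.

(** * Criteria for Gelfand pairs *)

Section GelfandCriteria.
Variables (R : realType) (gT : groupType) (H : set gT).
Local Notation X := (coset_space H).
Local Notation L2X := (l2 R X).
Implicit Types (f h v : L2X) (g : gT) (x y z : X) (c : R[i]) (V : set L2X).

Lemma translateKV g : cancel (@translate gT H g^-1%g) (@translate gT H g).
Proof. by move=> x; rewrite -{1}(invgK g) translateK. Qed.

Lemma sqnorm_quasi_regular g f : sqnorm (quasi_regular g f) = sqnorm f.
Proof. by rewrite /sqnorm /= sqsum_translate. Qed.

Lemma quasi_regular_linear g c f h :
  quasi_regular g (c *: f + h) = c *: quasi_regular g f + quasi_regular g h.
Proof. exact/val_inj. Qed.

Lemma quasi_regularD g f h : quasi_regular g (f + h) = quasi_regular g f + quasi_regular g h.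
Proof. exact/val_inj. Qed.

Lemma quasi_regularB g f h : quasi_regular g (f - h) = quasi_regular g f - quasi_regular g h.
Proof. exact/val_inj. Qed.

Lemma quasi_regularZ g c f : quasi_regular g (c *: f) = c *: quasi_regular g f.
Proof. exact/val_inj. Qed.

Lemma quasi_regularKV g f : quasi_regular g (quasi_regular g^-1%g f) = f.
Proof. by apply/val_inj/funext => x; rewrite /= invgK translateKV. Qed.

(** An inequality in [R[i]] compares real parts and forces equal imaginary parts, so the real part
    of [M] already gives the bound. *)
Lemma bounded_sqnorm V (A : L2X -> L2X) :
  (exists M : R[i], forall f, V f -> `|A f| <= M * `|f|) <->
  exists K : R, 0 <= K /\ forall f, V f -> sqnorm (A f) <= K * sqnorm f.
Proof.
split=> [[M MP]|[K [K0 KP]]].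
  exists (complex.Re M ^+ 2); split=> [|f Vf]; first exact: sqr_ge0.
  have := MP f Vf; rewrite !l2_normE.
  have -> : M * (Num.sqrt (sqnorm f))%:C =
      (complex.Re M * Num.sqrt (sqnorm f) +i* (complex.Im M * Num.sqrt (sqnorm f)))%C.
    by case: M {MP} => a b /=; apply/eqP; rewrite eq_complex /= !mulr0 subr0 add0r !eqxx.
  rewrite lecE /= => /andP [_ le].
  rewrite -(sqr_sqrtr (sqnorm_ge0 (A f))) -(sqr_sqrtr (sqnorm_ge0 f)) -exprMn.
  by apply: lerXn2r => //; rewrite ?nnegrE ?sqrtr_ge0 // (le_trans _ le) ?sqrtr_ge0.
exists (Num.sqrt K)%:C => f Vf; rewrite !l2_normE -rmorphM lecR -sqrtrM //.
exact/ler_wsqrtr/KP.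
Qed.

Lemma kernel_closed (A : L2X -> L2X) (K : R) :
  (forall f h, A (f - h) = A f - A h) -> 0 <= K ->
  (forall f, sqnorm (A f) <= K * sqnorm f) -> closed [set f | A f = 0].
Proof.
move=> AB K0 AK; apply: sqnorm_closed => p pA /=; apply: sqnorm_eq0; apply/eqP.
rewrite eq_le sqnorm_ge0 andbT; apply/ler_addgt0Pr => e e0; rewrite add0r.
have K1 : 0 < K + 1 by rewrite ltr_wpDl.
have [f /= Af fe] := pA (e / (K + 1)) (divr_gt0 e0 K1).
have -> : A p = A (p - f) by rewrite AB Af subr0.
apply: le_trans (AK _) _; apply: le_trans (ler_wpM2l K0 fe) _.
rewrite mulrCA; apply: ler_piMr; first exact: ltW.
by rewrite ler_pdivrMr // mul1r lerDl.
Qed.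

Lemma orth_proj_quasi_regular V (V0 : V 0)
    (VL : forall c f h, V f -> V h -> V (c *: f + h)) (Vc : closed V) :
  (forall g f, V f -> V (quasi_regular g f)) ->
  forall g f, orth_proj V0 VL Vc (quasi_regular g f) = quasi_regular g (orth_proj V0 VL Vc f).
Proof.
move=> VG g f; apply: orth_proj_unique; first by apply: VG; exact: orth_proj_in.
move=> v Vv; rewrite -(quasi_regularKV g v) -quasi_regularB -quasi_regularD.
rewrite !sqnorm_quasi_regular orth_projP ?sqnorm_quasi_regular //; exact: VG.
Qed.

Definition linear_of (A : L2X -> L2X) (AL : linear A) : {linear L2X -> L2X} :=
  HB.pack_for {linear L2X -> L2X} A (GRing.isLinear.Build _ _ _ _ A AL).

Lemma hecke_algebraP (A : {linear L2X -> L2X}) : hecke_algebra A <->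
  (exists K : R, 0 <= K /\ forall f, sqnorm (A f) <= K * sqnorm f) /\
  forall g f, A (quasi_regular g f) = quasi_regular g (A f).
Proof.
have [to_K of_K] := bounded_sqnorm setT A.
split=> -[[M MP] AG]; split=> //.
  have [|K [K0 KP]] := to_K; first by exists M.
  by exists K; split=> // f; exact: KP.
by have [|K KP] := of_K; [exists M; have [? ?] := MP; split|exists K => f; exact: KP].
Qed.

(** The list [s] encodes the annihilating polynomial $\prod_{l\in s}(X-l)$, applied factor by
    factor. *)
Lemma multiplicity_free_of_commutative : hecke_commutative R H ->
  (forall A, hecke_algebra A ->
     exists s : seq R[i], forall f, foldl (fun h l => A h - l *: h) f s = 0) ->
  multiplicity_free R H.
Proof.
move=> comm alg V [[V0 VL Vc VG] Vn0 Vmin].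
exists id; split; first split=> //.
- by exists 1 => f _; rewrite mul1r.
- apply: contra_notP Vn0 => nV; apply/seteqP; split=> [f Vf|_ ->//].
  by apply: contra_notP nV => f0; exists f.
move=> T [TL Tb TG].
pose P := orth_proj V0 VL Vc.
have PV f : V (P f) by exact: orth_proj_in.
have Pid f : V f -> P f = f by exact: orth_proj_id.
have PL : linear P by exact: orth_proj_linear.
have AL : linear (T \o P) by move=> c f h /=; rewrite PL TL.
have [K [K0 KP]] := (bounded_sqnorm V T).1 Tb.
have AK f : sqnorm ((T \o P) f) <= K * sqnorm f.
  by apply: le_trans (KP _ (PV f)) _; rewrite ler_wpM2l // orth_proj_le.
have PH : hecke_algebra (linear_of PL).
  apply/hecke_algebraP; split=> [|g f]; last exact: orth_proj_quasi_regular.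
  by exists 1; split=> // f; rewrite mul1r; exact: orth_proj_le.
have AH : hecke_algebra (linear_of AL).
  apply/hecke_algebraP; split=> [|g f]; first by exists K.
  by rewrite /= /P orth_proj_quasi_regular // TG.
(* Commutation of $TP$ with $P$ gives $Tv=PTv$ on [V]. *)
have TV v : V v -> V (T v).
  move=> Vv; have /(congr1 (fun F => F v)) /= := comm _ _ AH PH.
  by rewrite !(Pid v Vv) => ->; exact: PV.
have [s sP] := alg _ AH.
have {sP} [f [Vf f0 fs]] : exists f, [/\ V f, f <> 0
    & foldl (fun h l => T (P h) - l *: h) f s = 0].
  apply: contra_notP Vn0 => nV; apply/seteqP; split=> [f Vf|_ ->//].
  by apply: contra_notP nV => f0; exists f; split=> //; exact: sP.
have VB h k : V h -> V k -> V (h - k).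
  by move=> Vh Vk; rewrite addrC -scaleN1r; exact: (VL _ _ _).
have VZ c h : V h -> V (c *: h) by move=> Vh; rewrite -[_ *: _]addr0; exact: (VL _ _ _).
(* Applying the factors in turn leads from a nonzero vector to 0; the vector just before the first 0
   is an eigenvector. *)
have [c [v [Vv v0 Tv]]] : exists c v, [/\ V v, v <> 0 & T v = c *: v].
  elim: s f Vf f0 fs => [|l s IH] f Vf f0 //= fs.
  have [e|ne] := eqVneq (T (P f) - l *: f) 0.
    by exists l, f; split=> //; apply/eqP; rewrite -subr_eq0 -{1}(Pid f Vf) e.
  by apply: IH fs; [rewrite Pid //; apply: VB; [exact: TV|exact: VZ] | exact/eqP].
pose B h := T (P h) - c *: h.
have BL k h1 h2 : B (k *: h1 + h2) = k *: B h1 + B h2.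
  rewrite /B PL TL // scalerBr scalerDr !scalerA [c * k]mulrC opprD.
  by rewrite addrACA.
have BB h k : B (h - k) = B h - B k.
  by rewrite addrC -scaleN1r BL scaleN1r addrC.
have BG g h : B (quasi_regular g h) = quasi_regular g (B h).
  by rewrite /B /P orth_proj_quasi_regular // TG // quasi_regularB quasi_regularZ.
(* The eigenspace is a nonzero closed invariant subspace, hence all of [V]. *)
pose W := V `&` [set h | B h = 0].
have WV : W = V.
  have [] := Vmin W _ (@subIsetl _ _ _).
  - split.
    + by split=> //=; rewrite -[in B _](subrr 0) BB subrr.
    + move=> k h1 h2 [V1 B1] [V2 B2]; split=> /=; first exact: (VL _ _ _).
      by rewrite BL B1 B2 scaler0 addr0.
    + apply: closedI => //; apply: (kernel_closed BB (K := 2 * K + 2 * normc2 c)).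
        by rewrite addr_ge0 ?mulr_ge0 ?normc2_ge0.
      move=> h; apply: le_trans (sqnormD_le _ _) _; rewrite sqnormN sqnormZ.
      by rewrite [leRHS]mulrDl -!mulrA lerD2r ler_pM2l // AK.
    + move=> g h [Vh Bh]; split=> /=; first exact: VG.
      by rewrite BG Bh; exact/val_inj.
  - move=> W0; suff : W v by rewrite W0.
    by split=> //=; rewrite /B Pid // Tv subrr.
  - by [].
exists c => h Vh; have [_] : W h by rewrite WV.
by rewrite /= /B Pid // => /eqP; rewrite subr_eq0 => /eqP.
Qed.

Lemma normc2_eq0 (z : R[i]) : normc2 z = 0 -> z = 0.
Proof.
case: z => a b; rewrite /normc2 /= => /eqP.
by rewrite paddr_eq0 ?sqr_ge0 // !sqrf_eq0 => /andP [/eqP -> /eqP ->].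
Qed.

Let delta_fun x : X -> R[i]^o := fun y => (y == x)%:R.

Lemma sqsum_delta x : sqsum (delta_fun x) = 1%E.
Proof.
rewrite -(@esum_set1 R X x (fun=> 1%E)) ?lee_fin // esum_mkcond.
apply: eq_esum => y _; rewrite /delta_fun.
have -> : (y \in [set x]) = (y == x).
  by apply/idP/eqP => [/set_mem|->] //; exact/mem_set.
by case: eqP => _; rewrite /normc2 /= ?expr1n expr0n addr0.
Qed.

Lemma delta_subproof x : square_summable (delta_fun x).
Proof. by rewrite /square_summable /= sqsum_delta ltry. Qed.

Definition delta x : L2X := L2 (delta_subproof x).

Lemma deltaE x y : delta x y = (y == x)%:R.
Proof. by []. Qed.

Lemma sqnorm_delta x : sqnorm (delta x) = 1.
Proof. by rewrite /sqnorm /= sqsum_delta. Qed.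

Lemma quasi_regular_delta g x : quasi_regular g (delta x) = delta (translate g x).
Proof.
apply/val_inj/funext => y; rewrite /= /delta_fun; congr (_ %:R : R[i]); congr nat_of_bool.
by apply/eqP/eqP => [<-|->]; rewrite ?translateKV ?translateK.
Qed.

Lemma equivariant_kernel (A : L2X -> L2X) :
  (forall g f, A (quasi_regular g f) = quasi_regular g (A f)) ->
  forall g x y, A (delta (translate g x)) (translate g y) = A (delta x) y.
Proof. by move=> AG g x y; rewrite -quasi_regular_delta AG /= translateK. Qed.

(** * Finite quotients: transposition of kernels and annihilating polynomials *)

Section FiniteQuotient.
Variable s : seq X.
Hypothesis s_uniq : uniq s.
Hypothesis s_all : forall x, x \in s.

Lemma l2_scaleE c f x : (c *: f) x = c * f x.
Proof. by []. Qed.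

Lemma l2_sum_eval (I : Type) (r : seq I) (F : I -> L2X) y :
  (\sum_(i <- r) F i : L2X) y = \sum_(i <- r) F i y.
Proof. exact: (big_morph (fun h : L2X => h y)). Qed.

Lemma l2_delta_sum f : f = \sum_(x <- s) f x *: delta x.
Proof.
apply/val_inj/funext => y.
apply: etrans (esym (l2_sum_eval _ _ _)); rewrite (bigD1_seq y) // big1 => [|x /negPf xy].
  by rewrite l2_scaleE deltaE eqxx mulr1; exact: esym (addr0 _).
by rewrite l2_scaleE deltaE eq_sym xy mulr0.
Qed.

Lemma finite_kernelE (A : {linear L2X -> L2X}) f y :
  A f y = \sum_(x <- s) f x * A (delta x) y.
Proof.
rewrite {1}(l2_delta_sum f) linear_sum l2_sum_eval.
by apply: eq_bigr => x _; rewrite linearZ.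
Qed.

(* Twisting the kernel of an intertwiner by [theta] transposes it, so that
   [theta] turns [S \o T] into [T \o S]; both being invariant, they agree. *)
Lemma finite_hecke_commutative (theta : X -> X) : injective theta ->
  (forall x y, exists g, translate g (theta x) = y /\ translate g (theta y) = x) ->
  hecke_commutative R H.
Proof.
move=> theta_inj thetaP S T [_ SG] [_ TG].
have twist (A : L2X -> L2X) x y :
    (forall g f, A (quasi_regular g f) = quasi_regular g (A f)) ->
    A (delta (theta x)) (theta y) = A (delta y) x.
  move=> AG; have [g [gx gy]] := thetaP x y.
  by rewrite -(equivariant_kernel AG g) gx gy.
(* An injective self-map of a finite set is a permutation, so sums may be reindexed by [theta]. *)
have ps : perm_eq [seq theta x | x <- s] s.
  have um : uniq [seq theta x | x <- s] by rewrite map_inj_uniq.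
  apply: uniq_perm => //; have [//|_ //] := uniq_min_size um (fun x _ => s_all x).
  by rewrite size_map.
have ST x y : S (T (delta x)) y = T (S (delta x)) y.
  rewrite -(twist (T \o S)) => [|g f]; last by rewrite /= SG TG.
  rewrite /= [LHS]finite_kernelE [RHS]finite_kernelE -[RHS](perm_big _ ps) big_map.
  by apply: eq_bigr => z _; rewrite mulrC !twist.
apply/funext => f /=; rewrite (l2_delta_sum f) !linear_sum; apply: eq_bigr => x _.
rewrite !linearZ; congr (_ *: _).
by apply/val_inj/funext => z; exact: ST.
Qed.

(** Cayley-Hamilton for the matrix of [A] in the basis of delta functions; its characteristic
    polynomial splits over the complex numbers. Vectors are rows, so [A] acts by multiplication on
    the right. *)
Lemma finite_hecke_algebraic (A : {linear L2X -> L2X}) : s <> [::] ->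
  exists r : seq R[i], forall f, foldl (fun h l => A h - l *: h) f r = 0.
Proof.
case: s s_uniq s_all finite_kernelE => // x0 s' us sall kerE _.
pose n := size s'.
pose pt (i : 'I_n.+1) := nth x0 (x0 :: s') i.
pose M : 'M[R[i]]_n.+1 := \matrix_(i, j) A (delta (pt i)) (pt j).
pose vec f : 'rV[R[i]]_n.+1 := \row_i f (pt i).
have vecA f : vec (A f) = vec f *m M.
  apply/rowP => i; rewrite !mxE kerE (big_nth x0) big_mkord.
  by apply: eq_bigr => j _; rewrite !mxE.
have vec_inj f : vec f = 0 -> f = 0.
  move=> /rowP f0; apply/val_inj/funext => x.
  have xs : (index x (x0 :: s') < n.+1)%N by rewrite index_mem.
  by have := f0 (Ordinal xs); rewrite !mxE /pt nth_index.
have [r rP] := closed_field_poly_normal (char_poly M).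
exists r => f; apply: vec_inj.
have M0 : \prod_(z <- r) (M - z%:M) = 0.
  have := Cayley_Hamilton M; rewrite rP (monicP (char_poly_monic M)) scale1r.
  rewrite rmorph_prod /= => <-; apply: eq_bigr => z _.
  by rewrite rmorphB /= horner_mx_X horner_mx_C.
suff -> : vec (foldl (fun h l => A h - l *: h) f r) = vec f *m \prod_(z <- r) (M - z%:M).
  by rewrite M0 mulmx0.
elim: (r) (f) => [|z r' IH] h /=; first by rewrite big_nil mulmx1.
rewrite IH big_cons mulmxA; congr (_ *m _).
rewrite mulmxBr mul_mx_scalar -vecA; apply/rowP => i; rewrite !mxE.
by [].
Qed.

End FiniteQuotient.

(** * Quotients with infinite orbits outside the base point *)

Section InfiniteOrbits.
Variable x0 : X.
Hypothesis x0_fix : forall g, H g -> translate g x0 = x0.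
Hypothesis x0_trans : forall x, exists g, translate g x0 = x.
Hypothesis big_orbits : forall x n, x <> x0 -> exists t : seq X,
  [/\ uniq t, size t = n & forall y, y \in t -> exists2 g, H g & translate g x = y].

(** A fixed vector is constant on [H]-orbits, so square summability makes it vanish on the infinite
    ones. *)
Lemma fixed_vector f : (forall g, H g -> quasi_regular g f = f) -> f = f x0 *: delta x0.
Proof.
move=> fH; apply/val_inj/funext => x.
apply: etrans (esym (l2_scaleE _ _ _)); rewrite deltaE.
have [->|/eqP nx] := eqVneq x x0; first by rewrite mulr1.
rewrite mulr0; apply: contrapT => fx0.
have fx : 0 < normc2 (f x).
  rewrite lt_neqAle normc2_ge0 andbT eq_sym; apply/eqP => fx; apply: fx0.
  exact/normc2_eq0.
(* More than $|f|^2/|f(x)|^2$ points of the orbit of [x] contradict the bound of partial sums by the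
   squared norm. *)
have [t [ut st tP]] := big_orbits (Num.bound (sqnorm f / normc2 (f x))) nx.
have := sum_le_sqnorm f ut; rewrite big_seq.
rewrite (eq_bigr (fun=> normc2 (f x))) => [|y /tP [g Hg <-]]; last first.
  by rewrite -{1}(fH g Hg) /= translateK.
rewrite -big_seq big_const_seq count_predT iter_addr_0 st -mulr_natl -ler_pdivlMr //.
by apply/negP; rewrite -ltNge archi_boundP // divr_ge0 ?sqnorm_ge0 ?normc2_ge0.
Qed.

(** The image of the base delta function is fixed by [H], hence a multiple of it, and transitivity
    gives the same scalar on every delta function. The kernel of $A-c$ is closed and contains them
    all, so it is the whole space. *)
Lemma hecke_scalar (A : {linear L2X -> L2X}) : hecke_algebra A ->
  exists c, forall f, A f = c *: f.
Proof.
move=> /hecke_algebraP [[K [K0 AK]] AG].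
pose c := A (delta x0) x0; exists c.
have Ad x : A (delta x) = c *: delta x.
  have [g <-] := x0_trans x.
  rewrite -quasi_regular_delta AG -quasi_regularZ; congr quasi_regular.
  by apply: fixed_vector => h Hh; rewrite -AG quasi_regular_delta x0_fix.
pose B h := A h - c *: h.
have BL k h1 h2 : B (k *: h1 + h2) = k *: B h1 + B h2.
  rewrite /B linearP scalerBr scalerDr !scalerA [c * k]mulrC opprD.
  by rewrite addrACA.
have BB h k : B (h - k) = B h - B k.
  by rewrite addrC -scaleN1r BL scaleN1r addrC.
pose W := [set h | B h = 0].
have W0 : W 0 by rewrite /W /= -[in B _](subrr 0) BB subrr.
have WL k h1 h2 : W h1 -> W h2 -> W (k *: h1 + h2).
  by rewrite /W /= => W1 W2; rewrite BL W1 W2 scaler0 addr0.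
have Wc : closed W.
  apply: (kernel_closed BB (K := 2 * K + 2 * normc2 c)).
    by rewrite addr_ge0 ?mulr_ge0 ?normc2_ge0.
  move=> h; apply: le_trans (sqnormD_le _ _) _; rewrite sqnormN sqnormZ.
  by rewrite [leRHS]mulrDl -!mulrA lerD2r ler_pM2l // AK.
move=> f; suff : W f by rewrite /W /= /B => /eqP; rewrite subr_eq0 => /eqP.
pose g := f - orth_proj W0 WL Wc f.
suff g0 : g = 0.
  by rewrite -(subrK (orth_proj W0 WL Wc f) f) -/g g0 add0r; exact: orth_proj_in.
apply/val_inj/funext => x /=.
(* Adding this vector erases the coordinate [x] of [g], which cannot increase the norm, whereas
   orthogonality says that it adds $|g(x)|^2$; hence $g(x)=0$. *)
have Wd : W (- g x *: delta x).
  rewrite -[_ *: _]addr0; apply: (WL _ _ _) => //.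
  by rewrite /W /= /B Ad subrr.
have := @orth_projP _ _ _ W0 WL Wc f _ Wd.
rewrite -/g sqnormZ sqnorm_delta mulr1.
have le_g : sqnorm (g + - g x *: delta x) <= sqnorm g.
  rewrite -lee_fin !sqnormE; apply: le_esum => y _; rewrite lee_fin.
  have -> : (g + - g x *: delta x) y = g y + (- g x) * delta x y by [].
  rewrite deltaE; have [->|_] := eqVneq y x.
    by rewrite mulr1 subrr [leLHS](_ : _ = 0) ?normc2_ge0 // /normc2 /= expr0n addr0.
  by rewrite mulr0 addr0.
have : normc2 (- g x) = normc2 (g x).
  by rewrite /normc2; case: (g x) => a b /=; rewrite !sqrrN.
move=> -> gE; apply: normc2_eq0; apply/eqP; rewrite eq_le normc2_ge0 andbT.
by move: le_g; rewrite gE gerDl.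
Qed.

Lemma infinite_gelfand_pair : gelfand_pair R H.
Proof.
have comm : hecke_commutative R H.
  move=> S T /hecke_scalar [a aS] /hecke_scalar [b bT]; apply/funext => f /=.
  by rewrite !aS !bT !scalerA mulrC.
split=> //; apply: multiplicity_free_of_commutative => // A /hecke_scalar [c cA].
by exists [:: c] => f /=; rewrite cA subrr.
Qed.

End InfiniteOrbits.

Lemma finite_gelfand_pair (s : seq X) (theta : X -> X) :
  (forall x, x \in s) -> injective theta ->
  (forall x y, exists g, translate g (theta x) = y /\ translate g (theta y) = x) ->
  gelfand_pair R H.
Proof.
move=> sall ti tP; have us := undup_uniq s.
have uall x : x \in undup s by rewrite mem_undup.
have comm := finite_hecke_commutative us uall ti tP.
split=> //; apply: multiplicity_free_of_commutative => // A _.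
apply: (finite_hecke_algebraic us uall) => s0.
have x : X by exists (left_coset 1%g H), 1%g.
by have := uall x; rewrite s0.
Qed.

End GelfandCriteria.

(** * Orbits of branching groups *)

Section OrbitModel.
Variables (gT : groupType) (Y : Type) (act : gT -> Y -> Y) (y0 : Y).
Hypothesis act1 : forall y, act 1%g y = y.
Hypothesis actM : forall g h y, act (g * h)%g y = act g (act h y).

Definition stabilizer : set gT := [set g | act g y0 = y0].
Local Notation X := (coset_space stabilizer).
Implicit Types (x : X) (g h : gT).

Definition coset_of g : X :=
  CosetSpace (ex_intro (fun h => left_coset g stabilizer = left_coset h stabilizer) g erefl).

Lemma coset_ofP x : exists g, x = coset_of g.
Proof. by have [g xg] := coset_setP x; exists g; exact: coset_space_inj. Qed.

(** Identifies the coset of $g$ modulo the stabilizer with the point $g y_0$ of the orbit; the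
    choice of representative does not affect the value. *)
Definition point x : Y := act (projT1 (cid (coset_setP x))) y0.

Lemma point_coset_of g : point (coset_of g) = act g y0.
Proof.
rewrite /point; case: cid => h /= gh.
have : left_coset h stabilizer h by exists 1%g; rewrite ?mulg1 //; exact: act1.
by rewrite -gh => -[k kP <-]; rewrite actM kP.
Qed.

Lemma translate_coset_of g h : translate g (coset_of h) = coset_of (g * h)%g.
Proof. by apply: coset_space_inj; rewrite /= left_cosetM. Qed.

Lemma point_translate g x : point (translate g x) = act g (point x).
Proof.
by have [h ->] := coset_ofP x; rewrite translate_coset_of !point_coset_of actM.
Qed.

Lemma point_inj : injective point.
Proof.
have actV g y : act g^-1%g (act g y) = y by rewrite -actM mulVg act1.
have sub g h : act g y0 = act h y0 -> left_coset g stabilizer `<=` left_coset h stabilizer.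
  move=> gh _ [k kP <-]; exists (h^-1 * g * k)%g; last by rewrite !mulgA mulgV mul1g.
  by rewrite /stabilizer /= !actM kP gh actV.
move=> x y; have [g ->] := coset_ofP x; have [h ->] := coset_ofP y.
rewrite !point_coset_of => gh; apply: coset_space_inj => /=.
by apply/seteqP; split; apply: sub.
Qed.

End OrbitModel.

Section BranchingGroups.
Variables (R : realType) (d : nat) (A : set (tree_aut d.+2)).
Hypothesis A_branching : self_replicating_branching (generated A).
Local Notation gT := (gen_group A).
Implicit Types (e : ray d.+2) (g : gT) (u v w : word d.+2).

Let of_gen g : generated A (val g).
Proof. by case: g => g gA /=; apply/set_mem. Qed.

Let to_gen (k : tree_aut d.+2) : generated A k -> exists g : gT, val g = k.
Proof. by move=> kA; exists (GenGroup (mem_set kA)). Qed.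

Lemma stabilizer_pairs u v u' v' :
  size u = size v -> size u' = size u -> size v' = size u ->
  pair_type u v = pair_type u' v' ->
  exists g : gT, val g u = u' /\ val g v = v'.
Proof.
have [M [shift lift pair branch Mt]] := A_branching.
move=> s1 s2 s3 T; have sG := generated_subgroup A.
have [k [/to_gen [g <-] gu gv]] := pair_transitive sG shift lift pair branch Mt s1 s2 s3 T.
by exists g.
Qed.

Lemma pair_type_diag u : pair_type u u = nseq (size u) 0.
Proof. by elim: u => //= x u ->; rewrite eqxx. Qed.

Lemma stab_vertex_gelfand w : gelfand_pair R (stab_vertex A w).
Proof.
pose act (g : gT) (u : word d.+2) := val g u.
have act1 u : act 1%g u = u by [].
have actM (g h : gT) u : act (g * h)%g u = act g (act h u) by [].
have -> : stab_vertex A w = stabilizer act w by [].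
pose pt := point (act := act) (y0 := w).
have pt_inj : injective pt := point_inj act1 actM.
have pt_tr g x : pt (translate g x) = act g (pt x) := point_translate act1 actM g x.
have size_pt x : size (pt x) = size w.
  have [g ->] := coset_ofP x; rewrite /pt (point_coset_of w act1 actM).
  exact: size_aut.
have surj u : size u = size w -> exists x, pt x = u.
  (* Diagonal pairs of one level all have the same type, whence transitivity on the level. *)
  move=> uw; have [||||g [gw _]] := @stabilizer_pairs w w u u; rewrite ?pair_type_diag ?uw //.
  by exists (coset_of act w g); rewrite /pt (point_coset_of w act1 actM).
have opp_ex x : exists x', pt x' = opp_word (pt x).
  by apply: surj; rewrite size_map.
(* Negation of all letters, transported to the cosets. *)
pose theta x := projT1 (cid (opp_ex x)).
have thetaE x : pt (theta x) = opp_word (pt x) by rewrite /theta; case: cid.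
have tup_ex (t : (size w).-tuple 'I_d.+2) : exists x, pt x = t.
  by apply: surj; rewrite size_tuple.
pose s := [seq projT1 (cid (tup_ex t)) | t <- enum {: (size w).-tuple 'I_d.+2}].
apply: (@finite_gelfand_pair R _ _ s theta) => [x|x y xy|x y].
- have sx : size (pt x) == size w by rewrite size_pt.
  apply/mapP; exists (Tuple sx); first by rewrite mem_enum.
  by case: cid => y /= /pt_inj.
- by apply: pt_inj; apply: (can_inj (@opp_wordK d)); rewrite -!thetaE xy.
(* The negated pair has the type of the exchanged pair, so some [g] maps the former to the
   latter. *)
have [||||g [gx gy]] := @stabilizer_pairs (opp_word (pt x)) (opp_word (pt y)) (pt y) (pt x).
- by rewrite !size_map !size_pt.
- by rewrite size_map !size_pt.
- by rewrite size_map !size_pt.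
- exact: pair_type_opp.
by exists g; split; apply: pt_inj; rewrite pt_tr thetaE.
Qed.

Lemma ray_prefix_cat e m n :
  ray_prefix e (m + n) = ray_prefix e m ++ map e (iota m n).
Proof. by rewrite /ray_prefix /mkseq iotaD map_cat. Qed.

Lemma size_ray_prefix e n : size (ray_prefix e n) = n.
Proof. exact: size_mkseq. Qed.

(** Automorphisms respect prefixes, so fixing the deep vertices of the ray implies fixing the
    others. *)
Lemma stab_ray_intro e (k : tree_aut d.+2) m :
  (forall n, k (ray_prefix e (m + n)) = ray_prefix e (m + n)) ->
  forall n, k (ray_prefix e n) = ray_prefix e n.
Proof.
move=> kP n; have := kP n; rewrite addnC ray_prefix_cat.
have [t -> _] := aut_cat k (ray_prefix e n) (map e (iota n m)).
by move/eqP; rewrite eqseq_cat ?size_aut // => /andP [/eqP].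
Qed.

(* If [k] first leaves the ray below its vertex [w] of level [m], then the
   branching elements below [w] fix the ray and move [k e] freely. *)
Lemma stab_ray_orbit e (k : tree_aut d.+2) :
  (exists N, k (ray_prefix e N) != ray_prefix e N) ->
  forall n, exists N r, forall v, size v = n ->
    exists2 h : gT, stab_ray A e h & val h (k (ray_prefix e N)) = r ++ v.
Proof.
have [M [shift lift pair branch Mt]] := A_branching.
(* By minimality, [m.+1] is the first level at which [k] leaves the ray; level 0 is excluded since
   the root is fixed. *)
move=> kN n; case: (ex_minnP kN) => -[|m] km mmin; first by rewrite aut_nil in km.
set w := ray_prefix e m.
have kw : k w = w by apply/eqP; apply: contraT => /mmin; rewrite ltnn.
have pS l : ray_prefix e (m.+1 + l) = w ++ e m :: map e (iota m.+1 l).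
  by rewrite addSnnS ray_prefix_cat.
have [i ki] : exists i, k (ray_prefix e m.+1) = w ++ [:: i].
  have := pS 0; rewrite addn0 => ->.
  have [t -> st] := aut_cat k w (e m :: map e (iota m.+1 0)).
  by case: t st => [|i [|]] // _; exists i; rewrite kw.
have nij : i != e m.
  apply: contraNneq km => im; rewrite ki im.
  by have := pS 0; rewrite addn0 => ->.
(* The first [m.+1] letters lead to where [k] has left the ray, one more letter [z] is kept by the
   branching element, and the last [n] letters move freely. *)
exists (m.+1 + n.+1)%N.
have [t kt st] := aut_cat k (ray_prefix e m.+1) (map e (iota m.+1 n.+1)).
case: t st kt => [|z u] //=; rewrite size_map size_iota => -[su] kt.
exists (w ++ [:: i; z]) => v sv.
have [g Mg gu] := Mt u v (etrans su (esym sv)).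
have [kk [/to_gen [h hE] kj kz]] := branch_below lift branch w z nij Mg.
exists h.
  apply/funext => l; rewrite /= hE; apply: (@stab_ray_intro e kk m.+1) => l'.
  by rewrite pS kj.
by rewrite hE ray_prefix_cat kt ki -!catA /= kz gu.
Qed.

(** A ray is represented by the sequence of its prefixes. A coset outside the base point is a ray
    different from [e], and its orbit under the stabilizer of [e] is seen to be infinite by looking
    at one level [N] for each [n]. *)
Lemma stab_ray_gelfand e : gelfand_pair R (stab_ray A e).
Proof.
pose act (g : gT) (y : nat -> word d.+2) := aut_fun (val g) \o y.
have act1 y : act 1%g y = y by [].
have actM (g h : gT) y : act (g * h)%g y = act g (act h y) by [].
have -> : stab_ray A e = stabilizer act (ray_prefix e) by [].
pose pt := point (act := act) (y0 := ray_prefix e).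
have pt_inj : injective pt := point_inj act1 actM.
have pt_tr g x : pt (translate g x) = act g (pt x) := point_translate act1 actM g x.
have ptE g : pt (coset_of act (ray_prefix e) g) = act g (ray_prefix e).
  by rewrite /pt (point_coset_of (ray_prefix e) act1 actM).
apply: (@infinite_gelfand_pair R _ _ (coset_of act (ray_prefix e) 1%g)).
- by move=> g gP; apply: pt_inj; rewrite pt_tr ptE act1.
- move=> x; have [g ->] := coset_ofP x; exists g.
  by rewrite translate_coset_of mulg1.
move=> x n x_x0; have [g xg] := coset_ofP x.
have [|N [r NP]] := @stab_ray_orbit e (val g) _ n.
  apply: contra_notP x_x0 => gN; apply: pt_inj; rewrite xg !ptE.
  apply/funext => N /=; apply/eqP; apply: contra_notT gN => gN.
  by exists N.
have hP (v : n.-tuple 'I_d.+2) := NP v (size_tuple v).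
pose f (v : n.-tuple 'I_d.+2) := translate (projT1 (cid2 (hP v))) x.
have fE (v : n.-tuple 'I_d.+2) : pt (f v) N = r ++ v.
  by rewrite /f pt_tr xg ptE; case: cid2 => h /= _ <-.
(* There are $(d+2)^n>n$ words of length $n$, and distinct ones give translates that differ at level
   [N]. *)
exists (map f (take n (enum {: n.-tuple 'I_d.+2}))); split.
- rewrite map_inj_uniq; first by rewrite take_uniq // enum_uniq.
  move=> u v uv; apply: val_inj.
  have /eqP := congr1 (fun z => pt z N) uv.
  by rewrite !fE eqseq_cat // => /andP [_ /eqP].
- rewrite size_map size_takel // -cardE card_tuple card_ord.
  by apply/ltnW/ltn_expl.
by move=> y /mapP [v _ ->]; rewrite /f; case: cid2 => h hS hE; exists h.
Qed.

End BranchingGroups.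

Theorem mainTheorem6 (R : realType) (G : five_groups) (e : ray (arity G)) :
  gelfand_pair R (stab_ray (gens G) e) /\
  forall n : nat, gelfand_pair R (stab_vertex (gens G) (ray_prefix e n)).
Proof.
have generic d (A : set (tree_aut d.+2)) (e' : ray d.+2) :
    self_replicating_branching (generated A) ->
    gelfand_pair R (stab_ray A e') /\
    forall n : nat, gelfand_pair R (stab_vertex A (ray_prefix e' n)).
  by move=> br; split=> [|n]; [exact: stab_ray_gelfand | exact: stab_vertex_gelfand].
case: G e => e; apply: generic.
- exact: grigorchuk_branching.
- exact: grigorchuk_tilde_branching.
- exact: Gamma_branching.
- exact: Gamma_bar_branching.
- exact: Gamma_bar_bar_branching.
Qed.
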